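(* Let $n\ge 1$, let $(W_n,S_n)$ be of type $B_n$ and $(W_n',S_n')$ the associated Coxeter system of type $D_n$, as described in the context. Let $\mathrm{Res}_n:\Sigma(W_n)\to\Sigma(W_n')$ be the $\mathbb{Q}$-linear map given, for $I\subset S_n$, by $$\mathrm{Res}_n(x_I^{S_n})=\begin{cases} x^{S_n'}_{W_I\cap S_n'} & \text{if } t\in I,\\[2pt] x^{S_n'}_{I}+x^{S_n'}_{tIt^{-1}} & \text{if } t\notin I.\end{cases}$$ Put $x_n=1+t\in\mathbb{Q}W_n$. Then: (a) If $x\in\Sigma(W_n)$, then $x_n\,\mathrm{Res}_n(x)=x\,x_n$ in $\mathbb{Q}W_n$. (b) $\mathrm{Res}_n$ is a homomorphism of algebras. (c) If $n\ge2$, then $\mathrm{Res}^{S_n'}_{S_{n-1}'}\circ\mathrm{Res}_n=\mathrm{Res}_{n-1}\circ\mathrm{Res}^{S_n}_{S_{n-1}}$. (d) $\theta_n'\circ\mathrm{Res}_n=\mathrm{Res}^{W_n}_{W_n'}\circ\theta_n$ as maps $\Sigma(W_n)\to\mathbb{Q}\,\mathrm{Irr}\,W_n'$, where $\mathrm{Res}^{W_n}_{W_n'}:\mathbb{Q}\,\mathrm{Irr}\,W_n\to\mathbb{Q}\,\mathrm{Irr}\,W_n'$ is the restriction of characters. (e) The image of $\mathrm{Res}_n$ is $\Sigma(W_n')^{\sigma_n}$, the subalgebra of fixed points of $\sigma_n$.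
   Context: For a finite Coxeter system $(W,S)$ with length function $\ell$ and $I\subset S$: $W_I=\langle I\rangle$, $X_I^S=\{w\in W:\ell(ws)>\ell(w)\ \forall s\in I\}$, $x_I^S=\sum_{w\in X_I^S}w\in\mathbb{Q}W$, and the Solomon descent algebra is $\Sigma(W)=\bigoplus_{I\subset S}\mathbb{Q}x_I^S$, a unital subalgebra of $\mathbb{Q}W$ (Solomon). The linear map $\theta:\Sigma(W)\to\mathbb{Q}\,\mathrm{Irr}\,W$ sends $x_I^S$ to $\mathrm{Ind}_{W_I}^W 1$; here $\mathbb{Q}\,\mathrm{Irr}\,W=\mathbb{Q}\otimes_{\mathbb{Z}}\mathbb{Z}\,\mathrm{Irr}\,W$. For $K\subset S$, the restriction morphism $\mathrm{Res}^S_K:\Sigma(W)\to\Sigma(W_K)$ is the linear map with $\mathrm{Res}^S_K(x_I^S)=\sum_{d\in (X_K^S)^{-1}\cap X_I^S}x^K_{K\cap dId^{-1}}$. Let $(W_n,S_n)$ be a Coxeter system of type $B_n$ with $S_n=\{t,s_1,\dots,s_{n-1}\}$, where $ts_1$ has order 4, $s_is_{i+1}$ has order 3 for $1\le i\le n-2$, and all other pairs commute. Let $s_1'=ts_1t$, $S_n'=\{s_1',s_1,s_2,\dots,s_{n-1}\}$ (with $S_1'=\varnothing$) and $W_n'=\langle S_n'\rangle$; then $(W_n',S_n')$ is a Coxeter system of type $D_n$ and $W_n=\langle t\rangle\ltimes W_n'$. $\theta_n$ and $\theta_n'$ denote the maps $\theta$ for $(W_n,S_n)$ and $(W_n',S_n')$.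 Conjugation by $t$ is an automorphism $\sigma_n$ of $W_n'$ stabilizing $S_n'$ (exchanging $s_1$ and $s_1'$ and fixing the other $s_i$), and it induces an automorphism of $\Sigma(W_n')$ still denoted $\sigma_n$. For $n\ge 2$ we regard $S_{n-1}=\{t,s_1,\dots,s_{n-2}\}\subset S_n$ and $S_{n-1}'\subset S_n'$, so that $W_{n-1}$ and $W'_{n-1}$ are the corresponding standard parabolic subgroups of $W_n$ and $W_n'$. *)

(* Defs.v *)
From HB Require Import structures.
From mathcomp Require Import all_boot all_order all_fingroup all_algebra.
From mathcomp Require Import all_field all_character.

Set Implicit Arguments.
Unset Strict Implicit.
Unset Printing Implicit Defensive.

Import GroupScope GRing.Theory.
Local Open Scope ring_scope.

(* Functions gT -> rat under convolution.  The alias is needed because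
   {ffun gT -> rat^o} already carries the pointwise product.  For a subgroup W,
   QW is the subalgebra of functions supported on W. *)
Definition group_algebra (gT : finGroupType) : Type := {ffun gT -> rat^o}.

Section GroupAlgebra.

Variable gT : finGroupType.
Implicit Types (x y z : group_algebra gT) (g h : gT).

HB.instance Definition _ :=
  Vector.copy (group_algebra gT) {ffun gT -> rat^o}.

Definition gcoef x g : rat := (x : {ffun gT -> rat^o}) g.

Definition gelt g : group_algebra gT := [ffun h => (h == g)%:R].

Definition gmul x y : group_algebra gT :=
  [ffun g => \sum_h gcoef x h * gcoef y (h^-1 * g)%g].

Lemma gmulA : associative gmul.
Proof.
move=> x y z; apply/ffunP=> g; rewrite !ffunE /gcoef.
transitivity (\sum_h \sum_k
    gcoef x h * (gcoef y (h^-1 * k)%g * gcoef z (k^-1 * g)%g)).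
  apply: eq_bigr => h _; rewrite ffunE mulr_sumr.
  rewrite (reindex_inj (mulgI h^-1%g)); apply: eq_bigr => k _ /=.
  by rewrite invMg invgK -mulgA mulKVg.
rewrite exchange_big; apply: eq_bigr => k _; rewrite ffunE mulr_suml.
by apply: eq_bigr => h _; rewrite mulrA.
Qed.

Lemma gmul1l : left_id (gelt 1%g) gmul.
Proof.
move=> x; apply/ffunP=> g; rewrite ffunE (bigD1 1%g) //= big1 ?addr0.
  by rewrite /gcoef ffunE eqxx mul1r invg1 mul1g.
by move=> h /negPf h1; rewrite /gcoef ffunE h1 mul0r.
Qed.

Lemma gmul1r : right_id (gelt 1%g) gmul.
Proof.
move=> x; apply/ffunP=> g; rewrite ffunE (bigD1 g) //= big1 ?addr0.
  by rewrite /gcoef ffunE mulVg eqxx mulr1.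
move=> h /negPf hg; rewrite /gcoef ffunE.
by rewrite -eq_mulVg1 hg mulr0.
Qed.

Lemma gmulDl : left_distributive gmul +%R.
Proof.
move=> x y z; apply/ffunP=> g; rewrite !ffunE -big_split.
by apply: eq_bigr => h _; rewrite /gcoef ffunE mulrDl.
Qed.

Lemma gmulDr : right_distributive gmul +%R.
Proof.
move=> x y z; apply/ffunP=> g; rewrite !ffunE -big_split.
by apply: eq_bigr => h _; rewrite /gcoef ffunE mulrDr.
Qed.

Lemma gelt1_neq0 : gelt 1%g != 0.
Proof.
by apply/eqP=> /ffunP/(_ 1%g); rewrite !ffunE eqxx => /eqP; rewrite oner_eq0.
Qed.

HB.instance Definition _ := GRing.Zmodule_isNzRing.Build (group_algebra gT)
  gmulA gmul1l gmul1r gmulDl gmulDr gelt1_neq0.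

Lemma gscaleAl (a : rat) x y : a *: (x * y) = (a *: x) * y.
Proof.
apply/ffunP=> g; rewrite !ffunE scaler_sumr.
by apply: eq_bigr => h _; rewrite /gcoef ffunE -mulrA.
Qed.

HB.instance Definition _ :=
  GRing.Lmodule_isLalgebra.Build rat (group_algebra gT) gscaleAl.

Lemma gscaleAr (a : rat) x y : a *: (x * y) = x * (a *: y).
Proof.
apply/ffunP=> g; rewrite !ffunE scaler_sumr.
by apply: eq_bigr => h _; rewrite /gcoef ffunE mulrCA.
Qed.

HB.instance Definition _ :=
  GRing.Lalgebra_isAlgebra.Build rat (group_algebra gT) gscaleAr.

HB.instance Definition _ := Algebra_isFalgebra.Build rat (group_algebra gT).

Lemma gelt_mul g h : gelt g * gelt h = gelt (g * h)%g.
Proof.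
apply/ffunP=> k; rewrite ffunE (bigD1 g) //= big1 ?addr0.
  rewrite /gcoef !ffunE eqxx mul1r; congr (_%:R).
  by rewrite -(inj_eq (mulgI g)) mulKVg.
by move=> l /negPf lg; rewrite /gcoef ffunE lg mul0r.
Qed.

End GroupAlgebra.

Section Descent.

Variable gT : finGroupType.
Implicit Types (S I K : {set gT}) (w : gT).

(* (<<S>>, S) is a Coxeter system: S consists of involutions, and <<S>> is
   presented by S with the relations (r * r') ^+ #[r * r'] = 1 (the case
   r = r' gives r ^+ 2 = 1).  The presentation is expressed by its universal
   property with respect to all groups, finite or not. *)
Definition coxeter_system S : Prop :=
  (forall r, r \in S -> #[r]%g = 2%N) /\
  (forall (hT : groupType) (f : gT -> hT),
     (forall r r', r \in S -> r' \in S ->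
        ((f r * f r') ^+ #[r * r'])%g = 1%g) ->
     exists2 F : gT -> hT, {in <<S>>%g &, {morph F : u v / (u * v)%g}}
                         & {in S, F =1 f}).

(* The least k such that w is a product of k elements of S; see cox_lengthP.
   Here S ^+ k is the set of such products, and it suffices to search below
   #|gT| as a shortest word has pairwise distinct prefixes. *)
Definition cox_length S w : nat :=
  find (fun k => w \in (S ^+ k)%g) (iota 0 #|gT|).

Lemma mem_expset_path S k w :
  reflect (exists p, [/\ path (fun u v => u^-1 * v \in S)%g 1%g p,
                         last 1%g p = w & size p = k])
          (w \in (S ^+ k)%g).
Proof.
elim: k w => [|k IHk] w.
  rewrite expg0; apply: (iffP set1gP) => [->|[p [_ <- /size0nil->]]] //.
  by exists [::].
rewrite expgSr; apply: (iffP mulsgP) => [[u r /IHk[p [pP lp sp]] Sr ->] | ].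
  exists (rcons p (u * r)%g); split; last by rewrite size_rcons sp.
    by rewrite rcons_path pP lp mulKg.
  by rewrite last_rcons.
case=> p; case/lastP: p => [|p v] [] // pP lp sp.
move: pP lp sp; rewrite rcons_path last_rcons size_rcons.
case/andP=> pP Sv vw [sp].
exists (last 1%g p) ((last 1%g p)^-1 * v)%g => //; last by rewrite mulKVg.
by apply/IHk; exists p.
Qed.

Lemma cox_lengthP S w : w \in <<S>>%g ->
  w \in (S ^+ cox_length S w)%g /\
  (forall k, w \in (S ^+ k)%g -> (cox_length S w <= k)%N).
Proof.
move=> Sw.
have short k : w \in (S ^+ k)%g ->
    exists j, [/\ w \in (S ^+ j)%g, (j < #|gT|)%N & (j <= k)%N].
  case/mem_expset_path=> p [pP lp <-]; move: lp.
  case/shortenP: pP => q qP uq sub_qp lq.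
  exists (size q); split; first by apply/mem_expset_path; exists q.
    by rewrite -[_.+1]/(size (1%g :: q)) -(card_uniqP uq) max_card.
  by apply: uniq_leq_size => //; case/andP: uq.
have [k Sk] : exists k, w \in (S ^+ k)%g.
  case/gen_prodgP: Sw => k [c Sc ->]; exists k.
  elim: k c Sc => [|k IHk] c Sc; first by rewrite big_ord0 expg0 set11.
  by rewrite big_ord_recl expgS mem_mulg // IHk.
have findP j : w \in (S ^+ j)%g -> (j < #|gT|)%N -> (cox_length S w <= j)%N.
  move=> Sj ltj; rewrite leqNgt; apply/negP => /(before_find 0%N).
  by rewrite nth_iota // add0n Sj.
split=> [|j /short[i [Si lti leij]]]; last exact: leq_trans (findP i Si lti) _.
have [j [Sj ltj _]] := short k Sk.
have len_lt : (cox_length S w < #|gT|)%N := leq_ltn_trans (findP j Sj ltj) ltj.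
have := @nth_find _ 0%N (fun k => w \in (S ^+ k)%g) (iota 0 #|gT|).
by rewrite nth_iota // has_find size_iota; apply.
Qed.

Definition Xset S I : {set gT} :=
  [set w in <<S>>%g |
    [forall r in I, (cox_length S w < cox_length S (w * r)%g)%N]].

Definition xelt S I : group_algebra gT := \sum_(w in Xset S I) gelt w.

(* The family of the x_I for I a subset of S, indexed by ordinals:
   enum_val i : {set gT} is the i-th subset of S. *)
Definition xbasis S : #|powerset S|.-tuple (group_algebra gT) :=
  [tuple xelt S (enum_val i) | i < #|powerset S|].

Definition Sigma S : {vspace group_algebra gT} := <<xbasis S>>%VS.

(* The linear map Sigma(W) -> U sending x_I to v I for all subsets I of S
   (x_I being a basis of Sigma(W)).  Its values outside of Sigma(W) are
   immaterial. *)
Definition descent_map (U : vectType rat) S (v : {set gT} -> U) :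
    'Hom(group_algebra gT, U) :=
  linfun (fun x => \sum_i coord (xbasis S) i x *: v (enum_val i)).

Lemma descent_mapE (U : vectType rat) S (v : {set gT} -> U) x :
  descent_map S v x = \sum_i coord (xbasis S) i x *: v (enum_val i).
Proof.
pose f y := \sum_i coord (xbasis S) i y *: v (enum_val i).
have lin_f : linear f.
  move=> a y z; rewrite scaler_sumr -big_split; apply: eq_bigr => i _ /=.
  by rewrite linearP scalerDl scalerA.
pose flM := GRing.isLinear.Build _ _ _ _ f lin_f.
pose fL : {linear group_algebra gT -> U} := HB.pack f flM.
exact: (lfunE fL x).
Qed.

Definition Res_parabolic S K : 'End(group_algebra gT) :=
  descent_map S (fun I =>
    \sum_(d in (Xset S K)^-1%g :&: Xset S I) xelt K (K :&: (I :^ d^-1)%g)).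

(* QIrr(W) is identified with the Q-span of the irreducible characters inside
   the class functions over algC; this is lossless as irreducible characters
   are linearly independent over algC. *)
Definition theta S (x : group_algebra gT) : 'CF(<<S>>%g) :=
  \sum_i ratr (coord (xbasis S) i x) *: 'Ind[<<S>>%g, <<enum_val i>>%g] 1.

End Descent.

Section TypeBD.

Variables (gT : finGroupType) (n : nat) (t : gT) (s : nat -> gT).

(* Only the values s 1, ..., s n.-1 of s are relevant. *)
Definition gensB : {set gT} := t |: [set s i | i : 'I_n & (0 < i)%N].

Definition gensD : {set gT} :=
  if (n <= 1)%N then set0
  else (t * s 1%N * t)%g |: [set s i | i : 'I_n & (0 < i)%N].

(* The condition #|gensB| = n says that t, s 1, ..., s n.-1 are distinct. *)
Definition coxeter_type_B : Prop :=
  [/\ coxeter_system gensB,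
      #|gensB| = n,
      (1 < n)%N -> #[t * s 1%N]%g = 4%N,
      (forall i, (0 < i)%N -> (i.+1 < n)%N -> #[s i * s i.+1]%g = 3%N)
    & (forall i, (1 < i)%N -> (i < n)%N -> commute t (s i)) /\
      (forall i j, (0 < i)%N -> (i.+1 < j)%N -> (j < n)%N ->
         commute (s i) (s j))].

(* Note that t I t^-1 is I :^ t^-1, as conjugation is a right action. *)
Definition Res_BD : 'End(group_algebra gT) :=
  descent_map gensB (fun I =>
    if t \in I then xelt gensD (<<I>>%g :&: gensD)
    else xelt gensD I + xelt gensD (I :^ t^-1)%g).

Definition sigma_t : 'End(group_algebra gT) :=
  linfun (fun x => gelt t * x * gelt t^-1%g).

End TypeBD.

(* Main.v *)
From HB Require Import structures.
Require Import Defs.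
From mathcomp Require Import all_boot all_order all_fingroup all_algebra.
From mathcomp Require Import all_field all_character.
From mathcomp Require Import cyclic zify.

Set Implicit Arguments.
Unset Strict Implicit.
Unset Printing Implicit Defensive.

Import GRing.Theory Num.Theory.
Local Open Scope ring_scope.

(** Write W, W' for the groups of type B and D, and N(w) for the set of
reflections g with l(g w) < l(w).  These inversion sets obey the cocycle rule
N(uv) = N(u) + u N(v) u^-1 (sum = symmetric difference) with N(r) = {r} for
r in S, and conversely any such N controls length and descents: l(w) = #|N(w)|,
and l(wr) > l(w) iff r is not in N(w^-1).  A cocycle is produced from the
presentation by letting S act on signed elements of the group
([coxeter_cocycle]).  From it follow minimal coset representatives, the linear
independence of the x_I ([xbasis_free]), the decomposition of x_J along the
cosets of W_I ([mackey_xelt]) and with it Solomon's theorem ([Sigma_mul]).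

Type D is read off type B.  With R = S - {t}, the generators of W' are R and
its conjugate t R t, and t lies outside W' because W has a character equal
to -1 at t and to 1 on R: all the t r with r in R have even order.  Since W' is normal
of index 2 and no conjugate of t is in it, w |-> N(w) /\ W' is a cocycle for
the type D generators ([twist_cocycle]), and it vanishes on t.  So the whole
theory applies to W' with no further work.

The key fact is that Res_n x, for x in Sigma(W), is the image of x under the
linear map sending both v and vt to v, for v in W' ([glift_proj_xelt],
[Res_twistE]); this is a comparison of descent sets, one element at a time.
Hence x (1 + t) = Res_n(x) (1 + t), and right multiplication by 1 + t is
injective on QW'.

(a) Res_n(x) commutes with t, since conjugation by t sends x_J to x_{tJt}.
(b) Solomon's theorem puts xy in Sigma(W), and (a) lets 1 + t slide through
xy (1 + t) = x (1 + t) Res_n(y) = Res_n(x) Res_n(y) (1 + t).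
(c) On Sigma(W) the parabolic restriction to K replaces w = ud by u, where u is
in W_K and d is minimal in its coset ([Res_parabolicE]).  The components of w
in W_K and of its image in W' agree up to a right factor t, which 1 + t absorbs.
(d) Splitting W into W' and W't in the formula for induced characters gives
the restriction of Ind 1 as in Mackey's theorem.
(e) The fixed points are spanned by the sums x_J + x_{tJt}.  As t moves only
one element of R, each J or its conjugate lies in R, or J is t-stable; the
subsets {t} + (J /\ R) deal with the last case. *)

(** * Length and descents from a reflection cocycle *)

Section Cocycle.

Local Open Scope group_scope.

(** N w stands for the reflections g with l(g w) < l(w); the last clause is
N(uv) = N(u) + u N(v) u^-1 for the symmetric difference.  Unlike the Coxeter
presentation, this property passes at once to parabolic subgroups and to the
type D subgroup. *)
Definition reflection_cocycle {gT : finGroupType} (N : gT -> {set gT})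
    (S : {set gT}) : Prop :=
  [/\ {in S, forall r, r * r = 1},
      {in S, forall r, N r = [set r]}
    & {in <<S>> &, forall u v g,
         (g \in N (u * v)) = (g \in N u) (+) (g ^ u \in N v)}].

Variable gT : finGroupType.
Implicit Types (S I J K A : {set gT}) (u v w g r d : gT).

Lemma expset_gen {S k w} : w \in S ^+ k -> w \in <<S>>.
Proof.
elim: k w => [|k IHk] w; first by rewrite expg0 => /set1gP->; apply: group1.
by rewrite expgSr => /mulsgP[v q /IHk Sv Sq ->]; rewrite groupM // mem_gen.
Qed.

Lemma gen_ind_r S (P : gT -> Prop) :
  P 1 -> (forall u r, u \in <<S>> -> r \in S -> P u -> P (u * r)) ->
  forall w, w \in <<S>> -> P w.
Proof.
move=> P1 PM w /cox_lengthP[Sw _].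
move: (cox_length S w) Sw => k; elim: k w => [|k IHk] w.
  by rewrite expg0 => /set1gP->.
rewrite expgSr => /mulsgP[u r Su Sr ->].
by apply: PM => //; [apply: expset_gen Su | apply: IHk].
Qed.

Variable N : gT -> {set gT}.

Lemma cocycle_sub {S K} :
  reflection_cocycle N S -> K \subset S -> reflection_cocycle N K.
Proof.
case=> invS NS NM sKS; have sW := subsetP (genS sKS).
split=> [r /(subsetP sKS)|r /(subsetP sKS)|u v /sW Wu /sW Wv]; auto.
Qed.

Section Theory.

Variables (S : {set gT}) (cS : reflection_cocycle N S).

Let invS : {in S, forall r, r * r = 1}. Proof. by case: cS. Qed.
Let N_gen : {in S, forall r, N r = [set r]}. Proof. by case: cS. Qed.

Lemma cocycleM {u v g} : u \in <<S>> -> v \in <<S>> ->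
  (g \in N (u * v)) = (g \in N u) (+) (g ^ u \in N v).
Proof. by case: cS => _ _ NM Su Sv; apply: NM. Qed.

Lemma cocycle1 g : (g \in N 1) = false.
Proof.
have := @cocycleM 1 1 g (group1 _) (group1 _).
by rewrite mulg1 conjg1 addbb.
Qed.

Lemma cocycleV u g : u \in <<S>> -> (g \in N u^-1) = (g ^ u^-1 \in N u).
Proof.
move=> Su; have := @cocycleM u^-1 u g (groupVr Su) Su.
by rewrite mulVg cocycle1; case: (g \in _); case: (_ \in _).
Qed.

Lemma cocycle_gen u r g : u \in <<S>> -> r \in S ->
  (g \in N (u * r)) = (g \in N u) (+) (g == r ^ u^-1).
Proof.
move=> Su Sr; rewrite cocycleM ?(mem_gen Sr) // (N_gen Sr) inE.
by congr (_ (+) _); apply/eqP/eqP=> [<-|->]; rewrite ?conjgK ?conjgKV.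
Qed.

Lemma cocycle_subset u : u \in <<S>> -> N u \subset <<S>>.
Proof.
move=> Su; apply/subsetP=> g; move: u Su.
apply: gen_ind_r => [|u r Su Sr IH].
  by rewrite cocycle1.
rewrite cocycle_gen //; case: (g \in N u) IH => //= [-> //|_ /eqP->].
by rewrite groupJ ?groupV // mem_gen.
Qed.

Lemma card_cocycle_le k w : w \in S ^+ k -> (#|N w| <= k)%N.
Proof.
elim: k w => [|k IHk] w.
  rewrite expg0 => /set1gP->; rewrite leqn0 cards_eq0; apply/eqP/setP=> g.
  by rewrite cocycle1 inE.
rewrite expgSr => /mulsgP[u r Su Sr ->].
apply: (@leq_trans #|(r ^ u^-1) |: N u|).
  apply/subset_leq_card/subsetP=> g.
  rewrite cocycle_gen ?(expset_gen Su) // !inE.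
  by case: (g \in N u); case: (g == _).
by rewrite cardsU1 (leq_add (leq_b1 _) (IHk u Su)).
Qed.

(** Peel off the last letter r of a word ur of w: either g is already an
inversion of u, or g is the conjugate of r that cancels this letter. *)
Lemma strong_exchange k w g :
  w \in S ^+ k.+1 -> g \in N w -> g * w \in S ^+ k.
Proof.
elim: k w => [|k IHk] w; rewrite expgSr => /mulsgP[u r Su Sr ->].
  move: Su; rewrite expg0 => /set1gP->; rewrite mul1g (N_gen Sr) => /set1P->.
  by rewrite (invS Sr) set11.
rewrite cocycle_gen ?(expset_gen Su) //; case: (boolP (g \in N u)) => [Ng _|_].
  by rewrite mulgA expgSr mem_mulg // IHk.
move=> /eqP->.
by rewrite conjgE invgK !mulgA mulgKV -mulgA (invS Sr) mulg1.
Qed.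

(** Along a reduced word the cocycle grows by one reflection at each letter:
a reflection occurring twice would, by exchange, shorten the word by two. *)
Lemma cox_lengthE w : w \in <<S>> -> cox_length S w = #|N w|.
Proof.
move=> Sw; apply/eqP; rewrite eqn_leq; apply/andP; split; last first.
  by apply: card_cocycle_le; case: (cox_lengthP Sw).
have: w \in S ^+ cox_length S w by case: (cox_lengthP Sw).
have: forall k, w \in S ^+ k -> (cox_length S w <= k)%N.
  by case: (cox_lengthP Sw).
move: (cox_length S w) => k; elim: k w {Sw} => [|k IHk] w min_k //.
rewrite expgSr => /mulsgP[u r Su Sr def_w].
have min_u j : u \in S ^+ j -> (k <= j)%N.
  by move=> Sju; rewrite -ltnS min_k // def_w expgSr mem_mulg.
have lt_u := IHk u min_u Su.
have Ngu : r ^ u^-1 \notin N u.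
  apply/negP=> Nu; case: k {IHk lt_u} Su min_k min_u => [|k] Su min_k min_u.
    by move: Su Nu; rewrite expg0 => /set1gP->; rewrite cocycle1.
  have /min_k : w \in S ^+ k.
    have := strong_exchange Su Nu.
    by rewrite conjgE invgK !mulgA mulgKV def_w.
  by rewrite ltnNge leqW.
apply: leq_ltn_trans lt_u (proper_card _); apply/properP; split.
  apply/subsetP=> g Ng; rewrite def_w cocycle_gen ?(expset_gen Su) // Ng /=.
  by apply: contraNneq Ngu => <-.
exists (r ^ u^-1) => //.
by rewrite def_w cocycle_gen ?(expset_gen Su) // eqxx (negPf Ngu).
Qed.

Lemma card_cocycle_expset w : w \in <<S>> -> w \in S ^+ #|N w|.
Proof. by move=> Sw; rewrite -cox_lengthE //; case: (cox_lengthP Sw). Qed.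

Lemma cocycle_eq1 w : w \in <<S>> -> N w \subset set0 -> w = 1.
Proof.
move=> Sw; rewrite subset0 => /eqP Nw; have := card_cocycle_expset Sw.
by rewrite Nw cards0 expg0 => /set1gP.
Qed.

Lemma cox_length_ascent w r : w \in <<S>> -> r \in S ->
  (cox_length S w < cox_length S (w * r))%N = (r \notin N w^-1).
Proof.
move=> Sw Sr; have Swr : w * r \in <<S>> by rewrite groupM // mem_gen.
rewrite !cox_lengthE // cocycleV //; set q := r ^ _.
have NE g : (g \in N (w * r)) = (g \in N w) (+) (g == q) by exact: cocycle_gen.
case: (boolP (q \in N w)) => Nq /=.
  apply/negbTE; rewrite -leqNgt; apply/subset_leq_card/subsetP=> g.
  by rewrite NE; case: eqP => [->|_]; rewrite ?Nq ?addbF.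
apply/proper_card/properP; split.
  apply/subsetP=> g Ng; rewrite NE Ng /=.
  by apply: contraNneq Nq => <-.
by exists q => //; rewrite NE eqxx addbT.
Qed.

Lemma mem_Xset {I w} : I \subset S ->
  (w \in Xset S I) = (w \in <<S>>) && [forall r in I, r \notin N w^-1].
Proof.
move=> sIS; rewrite inE; apply: andb_id2l => Sw.
apply: eq_forallb_in => r /(subsetP sIS) Sr; exact: cox_length_ascent.
Qed.

Lemma mem_XsetV {I d} : I \subset S ->
  (d \in (Xset S I)^-1) = (d \in <<S>>) && [forall r in I, r \notin N d].
Proof. by move=> sIS; rewrite mem_invg mem_Xset // groupV invgK. Qed.

(** The last letter of a reduced word of w^-1 is a left descent of w. *)
Lemma cocycle_left_descent w : w \in <<S>> -> w != 1 ->
  exists2 r, r \in S & r \in N w.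
Proof.
move=> Sw w1; have := card_cocycle_expset (groupVr Sw).
case def_k: #|_| => [|k].
  by rewrite expg0 => /set1gP/eqP; rewrite eq_invg1 (negPf w1).
rewrite expgSr => /mulsgP[u r Su Sr def_w]; exists r => //.
apply: contraT => Nr; have := card_cocycle_le Su.
rewrite -(invgK w) -cox_length_ascent ?groupV // !cox_lengthE ?groupV // in Nr.
  by move: Nr; rewrite def_w -mulgA (invS Sr) mulg1 -def_w def_k; lia.
by rewrite groupM ?groupV // mem_gen.
Qed.

End Theory.

Section Parabolic.

Variables (S I : {set gT}) (cS : reflection_cocycle N S) (sIS : I \subset S).

Let cI : reflection_cocycle N I := cocycle_sub cS sIS.
Let sWI : <<I>> \subset <<S>> := genS sIS.

(** Take u so that d = u^-1 w is shortest in its coset: an inversion of d in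
<<I>> would, by exchange, give a shorter element of the same coset. *)
Lemma coset_decomp w : w \in <<S>> ->
  exists2 u, u \in <<I>> & [disjoint N (u^-1 * w) & <<I>>].
Proof.
move=> Sw.
case: (@arg_minnP _ 1 (mem <<I>>) (fun u => #|N (u^-1 * w)|) (group1 _)).
move=> u /= Iu min_u.
have Sd : u^-1 * w \in <<S>> by rewrite groupM ?groupV // (subsetP sWI).
exists u => //; apply/pred0Pn => -[v /andP[/= Nv Iv]].
have := card_cocycle_expset cS Sd.
case def_k: #|_| => [|k].
  by move/eqP: def_k; rewrite cards_eq0 => /eqP N0; rewrite N0 inE in Nv.
move=> /(strong_exchange cS)/(_ Nv)/(card_cocycle_le cS).
have /min_u : u * v^-1 \in <<I>> by rewrite groupM ?groupV.
by rewrite def_k invMg invgK mulgA => /leq_trans le /le; rewrite ltnn.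
Qed.

Lemma coset_cocycle u d g : u \in <<I>> -> d \in <<S>> ->
    [disjoint N d & <<I>>] -> g \in <<I>> ->
  (g \in N (u * d)) = (g \in N u).
Proof.
move=> Iu Sd dI Ig; rewrite (cocycleM cS) //; last exact: subsetP Iu.
by rewrite (disjointFl dI) ?addbF // groupJ.
Qed.

(** Being free of descents in I is thus the same as being minimal in the coset:
in d = u d' with d' minimal, d and u have the same inversions in <<I>>, so a
nontrivial u would yield a descent of d in I. *)
Lemma no_descent_disjoint d : d \in <<S>> -> {in I, forall r, r \notin N d} ->
  [disjoint N d & <<I>>].
Proof.
move=> Sd NId; have [u Iu dI] := coset_decomp Sd.
have [u1 | u1] := eqVneq u 1; first by move: dI; rewrite u1 invg1 mul1g.
have Su := subsetP sWI _ Iu.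
have [r Ir Nr] : exists2 r, r \in I & r \in N u.
  exact: cocycle_left_descent cI _ Iu u1.
have := NId r Ir; rewrite -(mulKVg u d) coset_cocycle ?Nr ?(mem_gen Ir) //.
by rewrite groupM ?groupV.
Qed.

Lemma XsetV_disjoint d :
  (d \in (Xset S I)^-1) = (d \in <<S>>) && [disjoint N d & <<I>>].
Proof.
rewrite (mem_XsetV cS) //; apply: andb_id2l => Sd.
apply/forall_inP/idP=> [|dI r Ir]; first exact: no_descent_disjoint.
by rewrite (disjointFl dI) ?mem_gen.
Qed.

Lemma Xset_disjoint w :
  (w \in Xset S I) = (w \in <<S>>) && [disjoint N w^-1 & <<I>>].
Proof. by rewrite -groupV -XsetV_disjoint mem_invg invgK. Qed.

Lemma gen_parabolic r : r \in S -> (r \in <<I>>) = (r \in I).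
Proof.
move=> Sr; apply/idP/idP=> [Ir | /mem_gen//].
have := card_cocycle_expset cI Ir.
by case: cS => _ /(_ r Sr)-> _; rewrite cards1 expg1.
Qed.

(** The quotient of two candidates has no inversion, hence is trivial. *)
Lemma coset_decomp_unique u u' w : w \in <<S>> -> u \in <<I>> -> u' \in <<I>> ->
    [disjoint N (u^-1 * w) & <<I>>] -> [disjoint N (u'^-1 * w) & <<I>>] ->
  u = u'.
Proof.
move=> Sw Iu Iu' dI d'I.
have Iv : u^-1 * u' \in <<I>> by rewrite groupM ?groupV.
apply/eqP; rewrite eq_mulVg1; apply/eqP/(cocycle_eq1 cI) => //.
apply/subsetP=> g Ng; have Ig := subsetP (cocycle_subset cI Iv) g Ng.
have := disjointFl dI Ig.
rewrite -(mulKVg u' w) mulgA coset_cocycle ?Ng //.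
by rewrite groupM ?groupV // (subsetP sWI).
Qed.

(** The longest element of <<I>>: all of I are descents by maximality, and no
other generator is, since the inversions of w stay inside <<I>>. *)
Lemma exists_descent_set :
  exists2 w, w \in <<S>> & {in S, forall r, (r \in N w^-1) = (r \in I)}.
Proof.
case: (@arg_maxnP _ 1 (mem <<I>>) (fun w => #|N w|) (group1 _)).
move=> w /= Iw max_w.
have {}Iw : w \in <<I>> := Iw; have Sw := subsetP sWI w Iw.
exists w => // r Sr; apply/idP/idP=> [Nr | Ir].
  rewrite -gen_parabolic //.
  by apply: subsetP (cocycle_subset cI _) _ Nr; rewrite groupV.
have Iwr : w * r \in <<I>> by rewrite groupM // mem_gen.
apply: contraLR (max_w _ Iwr); rewrite -(cox_length_ascent cS) // -ltnNge.
by rewrite !(cox_lengthE cS) // (subsetP sWI).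
Qed.

End Parabolic.

Lemma cocycle_eq0 S d : reflection_cocycle N S -> d \in <<S>> ->
  [disjoint N d & <<S>>] -> d = 1.
Proof.
move=> cS Sd dS; apply: (cocycle_eq1 cS) => //; apply/subsetP=> g Ng.
by have := subsetP (cocycle_subset cS Sd) g Ng; rewrite (disjointFr dS).
Qed.

Lemma card_cocycle1 S r :
  reflection_cocycle N S -> r \in <<S>> -> N r = [set r] -> r \in S.
Proof.
move=> cS Sr Nr; have := card_cocycle_expset cS Sr.
by rewrite Nr cards1 expg1.
Qed.

(** The factor u in <<I>> of w = u d, where d is minimal in its coset. *)
Definition coset_part I w : gT :=
  odflt 1 [pick u in <<I>> | [disjoint N (u^-1 * w) & <<I>>]].

Lemma coset_partP S I w :
    reflection_cocycle N S -> I \subset S -> w \in <<S>> ->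
  coset_part I w \in <<I>> /\ [disjoint N ((coset_part I w)^-1 * w) & <<I>>].
Proof.
move=> cS sIS Sw; rewrite /coset_part; case: pickP => [u /andP[] | noP] //=.
by have [u Iu dI] := coset_decomp cS sIS Sw; case/andP: (noP u).
Qed.

Lemma coset_partE S I u d : reflection_cocycle N S -> I \subset S ->
    u \in <<I>> -> d \in <<S>> -> [disjoint N d & <<I>>] ->
  coset_part I (u * d) = u.
Proof.
move=> cS sIS Iu Sd dI.
have Sud : u * d \in <<S>> by rewrite groupM // (subsetP (genS sIS)).
have [Ip pI] := coset_partP cS sIS Sud.
by apply: (coset_decomp_unique cS sIS Sud) => //; rewrite mulKg.
Qed.
End Cocycle.

(** * The cocycle of a Coxeter system *)

Section Existence.

Local Open Scope group_scope.

Variable gT : finGroupType.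
Implicit Types (S : {set gT}) (g r u v w : gT).

(** The generator r acts on signed group elements by conjugation, changing only
the sign of r itself.  The sign picked up by g along w tells whether g is an
inversion of w. *)
Definition signed_conj r (x : bool * gT) := (x.1 (+) (x.2 == r), x.2 ^ r).

Lemma signed_conj_inj r : injective (signed_conj r).
Proof.
case=> [b g] [b' g'] [+ /conjg_inj def_g]; rewrite /= def_g.
by case: b b' (_ == _) => [] [] [].
Qed.

Definition signed_perm r : {perm bool * gT} := perm (@signed_conj_inj r).

(** Signs change at the elements (r r')^j r, the reflections of the dihedral
group of r and r', met in their cyclic order. *)
Lemma signed_perm_dihedral r r' k b g : r * r = 1 -> r' * r' = 1 ->
  ((signed_perm r * signed_perm r') ^+ k) (b, g)
    = (b (+) \big[addb/false]_(j < k.*2) (g == (r * r') ^+ j * r),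
       g ^ ((r * r') ^+ k)).
Proof.
move=> rr rr'; set c := r * r'.
have rV : r^-1 = r by apply/eqP; rewrite eq_invg_mul rr.
have rV' : r'^-1 = r' by apply/eqP; rewrite eq_invg_mul rr'.
(* r inverts c, hence (c ^+ j) r (c ^+ j)^-1 = c ^+ (2 j) r. *)
have rc j : r * (c ^+ j)^-1 = c ^+ j * r.
  have /(congr1 (mulg r)): (c ^+ j) ^ r = (c ^+ j)^-1.
    by rewrite conjXg conjgE -expVgn invMg rV rV' !mulgA rr mul1g.
  by rewrite conjgE rV !mulgA rr mul1g => <-.
elim: k => [|k IHk]; first by rewrite big_ord0 addbF conjg1 perm1.
rewrite expgSr !permM IHk !permE /signed_conj /= doubleS !big_ord_recr /=.
rewrite -!addbA -!conjgM; congr (_ (+) (_ (+) (_ (+) _)), _);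
  last by rewrite expgSr mulgA.
  rewrite -addnn expgD -mulgA -rc; apply/eqP/eqP=> [<-|->].
    by rewrite conjgE !mulgA mulgV mul1g mulgK.
  by rewrite !conjgE !mulgA mulVg mul1g mulgKV.
have -> : c ^+ k.*2.+1 * r = r' ^ (c ^+ k * r)^-1.
  rewrite conjgE invgK invMg rV !mulgA -[_ * r * r']mulgA -/c -expgSr.
  by rewrite -[_ * r * _]mulgA rc mulgA -expgD addSn addnn.
by apply/eqP/eqP=> [<-|->]; rewrite ?conjgK ?conjgKV.
Qed.

(** After #[r * r'] steps every reflection of the dihedral group has been met
exactly twice, so all signs cancel. *)
Lemma signed_perm_relation r r' : r * r = 1 -> r' * r' = 1 ->
  (signed_perm r * signed_perm r') ^+ #[r * r'] = 1.
Proof.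
move=> rr rr'; apply/permP=> -[b g]; rewrite signed_perm_dihedral // perm1.
rewrite expg_order conjg1 -addnn big_split_ord /=.
under [X in _ (+) (_ (+) X)]eq_bigr do rewrite expgD expg_order mul1g.
by rewrite addbb addbF.
Qed.

Lemma coxeter_cocycle S :
  coxeter_system S -> exists N, reflection_cocycle N S.
Proof.
case=> ordS univ.
have invS : {in S, forall r, r * r = 1}.
  by move=> r /ordS o2; have := expg_order r; rewrite o2 expgS expg1.
have [|F FM FS] := univ _ signed_perm.
  by move=> r r' Sr Sr'; rewrite signed_perm_relation ?invS.
have F1 : F 1 = 1.
  by apply: (mulgI (F 1)); rewrite -FM ?group1 // !mulg1.
have FE w b g : w \in <<S>> -> F w (b, g) = (b (+) (F w (false, g)).1, g ^ w).
  move=> Sw; elim/gen_ind_r: w / Sw b g => [|u r Su Sr IHu] b g.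
    by rewrite F1 !perm1 addbF conjg1.
  rewrite FM ?(mem_gen Sr) // (FS _ Sr) !permM IHu (IHu false) !permE /=.
  by rewrite /signed_conj /= addbA conjgM.
exists (fun w => [set g | (F w (false, g)).1]); split=> // [r Sr | u v Su Sv g].
  by apply/setP=> g; rewrite !inE (FS _ Sr) permE.
by rewrite !inE FM // permM (FE u) // FE.
Qed.

End Existence.

(** * Solomon's descent algebra *)

Section GroupAlgebraMaps.

Variable gT : finGroupType.
Implicit Types (x y z : group_algebra gT) (g h w : gT) (A : {set gT}).

Lemma gcoefD x y g : gcoef (x + y) g = gcoef x g + gcoef y g.
Proof. by rewrite /gcoef ffunE. Qed.

Lemma gcoefZ (a : rat) x g : gcoef (a *: x) g = a * gcoef x g.
Proof. by rewrite /gcoef ffunE. Qed.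

Lemma gcoef0 g : gcoef (0 : group_algebra gT) g = 0.
Proof. by rewrite /gcoef ffunE. Qed.

Lemma gcoef_gelt h g : gcoef (gelt h) g = (g == h)%:R.
Proof. by rewrite /gcoef ffunE. Qed.

Lemma gcoef_sum (I : finType) (P : pred I) (F : I -> group_algebra gT) g :
  gcoef (\sum_(i | P i) F i) g = \sum_(i | P i) gcoef (F i) g.
Proof.
exact: (big_morph _ (fun x y => gcoefD x y g) (gcoef0 g)).
Qed.

Lemma gcoef_sum_gelt A g : gcoef (\sum_(w in A) gelt w) g = (g \in A)%:R.
Proof.
rewrite gcoef_sum; under eq_bigr do rewrite gcoef_gelt.
case: (boolP (g \in A)) => [Ag | /negPf nAg].
  rewrite (bigD1 g) //= eqxx big1 ?addr0 // => w /andP[_ /negPf].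
  by rewrite eq_sym => ->.
by rewrite big1 // => w Aw; case: eqP => // gw; rewrite gw Aw in nAg.
Qed.

Lemma geltE x : x = \sum_g gcoef x g *: gelt g.
Proof.
apply/ffunP=> h; rewrite -[LHS]/(gcoef x h) -[RHS]/(gcoef _ h) gcoef_sum.
rewrite (bigD1 h) //= gcoefZ gcoef_gelt eqxx mulr1 big1 ?addr0 //.
move=> g /negPf gh.
by rewrite gcoefZ gcoef_gelt eq_sym gh mulr0.
Qed.

(** The linear extension of f to the group algebra. *)
Definition glift (f : gT -> gT) x : group_algebra gT :=
  \sum_g gcoef x g *: gelt (f g).

Lemma glift_linear f : linear (glift f).
Proof.
move=> a x y; rewrite scaler_sumr -big_split; apply: eq_bigr => g _ /=.
by rewrite gcoefD gcoefZ scalerDl scalerA.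
Qed.

HB.instance Definition _ f :=
  GRing.isLinear.Build rat (group_algebra gT) (group_algebra gT) *:%R (glift f)
    (@glift_linear f).

Lemma glift_gelt f h : glift f (gelt h) = gelt (f h).
Proof.
rewrite /glift (bigD1 h) //= gcoef_gelt eqxx scale1r big1 ?addr0 //.
move=> g /negPf gh.
by rewrite gcoef_gelt gh scale0r.
Qed.

Definition gsupported A x := forall g, g \notin A -> gcoef x g = 0.

Lemma gsupportedM (W : {group gT}) x y :
  gsupported W x -> gsupported W y -> gsupported W (x * y).
Proof.
move=> sx sy g Wg; rewrite /gcoef ffunE big1 // => h _.
have [Wh | /sx->] := boolP (h \in W); last by rewrite mul0r.
by rewrite (sy (h^-1 * g)%g) ?mulr0 // groupMl ?groupV.
Qed.

Lemma gcoef_mul_gelt x h g : gcoef (x * gelt h) g = gcoef x (g * h^-1)%g.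
Proof.
rewrite {1}/gcoef ffunE (bigD1 (g * h^-1)%g) //= big1 ?addr0 => [|k /negPf kg].
  by rewrite gcoef_gelt invMg invgK mulgKV eqxx mulr1.
rewrite gcoef_gelt; case: (k^-1 * g =P h)%g kg => [<-|]; last by rewrite mulr0.
by rewrite invMg invgK mulKVg eqxx.
Qed.

(** For x supported on W, the product x * t is supported on a coset disjoint
from W, so x can be read off x * (1 + t). *)
Lemma gmul_1gelt_inj (W : {group gT}) t x y : t \notin W ->
    gsupported W x -> gsupported W y ->
  x * (1 + gelt t) = y * (1 + gelt t) -> x = y.
Proof.
move=> Wt sx sy eq_xy; apply/ffunP=> g.
rewrite -[LHS]/(gcoef x g) -[RHS]/(gcoef y g).
have [Wg | nWg] := boolP (g \in W); last by rewrite sx // sy.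
have := congr1 (fun z => gcoef z g) eq_xy.
rewrite !mulrDr !mulr1 !gcoefD !gcoef_mul_gelt.
have nWgt : (g * t^-1)%g \notin W by rewrite groupMl // groupV.
by rewrite (sx _ nWgt) (sy _ nWgt) !addr0.
Qed.

End GroupAlgebraMaps.

Section SolomonAlgebra.

Variables (gT : finGroupType) (N : gT -> {set gT}).
Implicit Types (S I J K : {set gT}) (x y : group_algebra gT) (w d u g r : gT).

Lemma nth_xbasis S (i : 'I_#|powerset S|) : (xbasis S)`_i = xelt S (enum_val i).
Proof. by rewrite -tnth_nth tnth_mktuple. Qed.

Lemma enum_val_subset S (i : 'I_#|powerset S|) : enum_val i \subset S.
Proof. by rewrite -powersetE enum_valP. Qed.

Lemma subset_enum_val S I : I \subset S ->
  exists i : 'I_#|powerset S|, I = enum_val i.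
Proof.
rewrite -powersetE => sI; exists (enum_rank_in sI I).
by rewrite enum_rankK_in.
Qed.

Lemma xelt_Sigma S I : I \subset S -> xelt S I \in Sigma S.
Proof.
move=> /subset_enum_val[i ->]; rewrite -nth_xbasis.
by rewrite memv_span // mem_nth // size_tuple.
Qed.

Lemma Sigma_ind S (P : group_algebra gT -> Prop) :
    P 0 -> (forall x y, P x -> P y -> P (x + y)) ->
    (forall (a : rat) x, P x -> P (a *: x)) ->
    (forall I, I \subset S -> P (xelt S I)) ->
  forall x, x \in Sigma S -> P x.
Proof.
move=> P0 PD PZ PX x /coord_span->; elim/big_rec: _ => // i y _ Py.
by apply: (PD) => //; apply: PZ; rewrite nth_xbasis; apply/PX/enum_val_subset.
Qed.

Section Cocycle.

Variables (S : {set gT}) (cS : reflection_cocycle N S).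

(** Triangularity: an element w with descent set S - J occurs in x_I exactly
when I is a subset of J, so the coefficients vanish by induction on #|J|. *)
Lemma xbasis_free : free (xbasis S).
Proof.
apply/freeP=> k k0 i; have [m] := ubnP #|enum_val i|.
elim: m i => // m IHm i le_m.
have [w Sw NwE] := exists_descent_set cS (subsetDl S (enum_val i)).
have XwE (j : 'I_#|powerset S|) : (w \in Xset S (enum_val j))
    = (enum_val j \subset enum_val i).
  have sjS := enum_val_subset j; rewrite (mem_Xset cS) // Sw /=.
  apply/forall_inP/subsetP=> [Xj r jr | sji r jr].
    have Sr := subsetP sjS r jr.
    by have := Xj r jr; rewrite NwE // inE Sr andbT negbK.
  by rewrite NwE ?(subsetP sjS) // inE sji.
have := congr1 (fun x => gcoef x w) k0.
rewrite gcoef0 gcoef_sum (bigD1 i) //= big1 => [|j ij].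
  by rewrite nth_xbasis gcoefZ gcoef_sum_gelt XwE subxx mulr1 addr0.
rewrite nth_xbasis gcoefZ gcoef_sum_gelt XwE.
have [sji | _] := boolP (_ \subset _); last by rewrite mulr0.
rewrite IHm ?mul0r //; apply: leq_trans (proper_card _) (ltnSE le_m).
by rewrite properEneq sji andbT (inj_eq enum_val_inj).
Qed.

Lemma coord_xelt (i j : 'I_#|powerset S|) :
  coord (xbasis S) i (xelt S (enum_val j)) = (j == i)%:R.
Proof. by rewrite -nth_xbasis coord_free ?xbasis_free. Qed.

Lemma descent_map_xelt (U : vectType rat) (v : {set gT} -> U) I :
  I \subset S -> descent_map S v (xelt S I) = v I.
Proof.
move=> /subset_enum_val[i ->]; rewrite descent_mapE (bigD1 i) //=.
rewrite coord_xelt eqxx scale1r big1 ?addr0 // => j /negPf ij.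
by rewrite coord_xelt eq_sym ij scale0r.
Qed.

Lemma theta_xelt I : I \subset S ->
  theta S (xelt S I) = 'Ind[<<S>>%g, <<I>>%g] 1.
Proof.
move=> /subset_enum_val[i ->]; rewrite /theta (bigD1 i) //=.
rewrite coord_xelt eqxx rmorph1 scale1r big1 ?addr0 // => j /negPf ij.
by rewrite coord_xelt eq_sym ij rmorph0 scale0r.
Qed.

(** As d is minimal, the inversions of (ud)^-1 among J are those of d^-1
together with the conjugates by d of the inversions of u^-1.  Here
q = d r d^-1 matters only if it lies in <<I>>; then it is the sole inversion of
d r in <<I>>, thus its own sole inversion, which makes it a generator. *)
Lemma Xset_coset_r I J u d : I \subset S -> J \subset S ->
    u \in <<I>>%g -> d \in ((Xset S I)^-1)%g ->
  (u * d \in Xset S J)%g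
    = (d \in Xset S J) && (u \in Xset I (I :&: (J :^ d^-1)%g)).
Proof.
move=> sIS sJS Iu; rewrite (XsetV_disjoint cS) // => /andP[Sd dI].
have cI := cocycle_sub cS sIS; have sWI := subsetP (genS sIS).
have Su := sWI u Iu; have sNu := subsetP (cocycle_subset cI (groupVr Iu)).
rewrite !(mem_Xset cS) // (mem_Xset cI) ?subsetIl // Iu Sd groupM //=.
have NE r : (r \in N (u * d)^-1)%g
    = (r \in N d^-1)%g || (r ^ d^-1 \in N u^-1)%g.
  rewrite invMg (cocycleM cS) ?groupV // (cocycleV cS) //.
  have [/(disjointFr dI) Ir | _] //= := boolP (_ \in N d)%g.
  by apply/negP=> /sNu; rewrite Ir.
apply/forall_inP/andP=> [NJ | [/forall_inP NdJ /forall_inP NuI] r Jr].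
  split; apply/forall_inP=> r; first by move/NJ; rewrite NE => /norP[].
  rewrite inE mem_conjgV => /andP[_ /NJ]; rewrite NE => /norP[_].
  by rewrite conjgK.
rewrite NE negb_or NdJ //=; apply/negP=> Nq; set q := (r ^ d^-1)%g in Nq.
have Iq : q \in I.
  apply: (card_cocycle1 cI); first exact: sNu.
  apply/setP=> g; rewrite inE; have [Ig | nIg] := boolP (g \in <<I>>%g).
    rewrite -(coset_cocycle cS sIS (sNu q Nq) Sd dI Ig).
    have ->: (q * d = d * r)%g by rewrite /q conjgE invgK -!mulgA mulVg mulg1.
    by rewrite (cocycle_gen cS) ?(disjointFl dI) // (subsetP sJS).
  have [gq | _] := eqVneq g q; first by rewrite gq sNu in nIg.
  by apply: contraNF nIg => /(subsetP (cocycle_subset cI (sNu q Nq))).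
by have := NuI q; rewrite inE Iq mem_conjgV /q conjgKV Jr Nq => /(_ isT).
Qed.

Lemma Xset_coset_l I K a u : K \subset I -> I \subset S ->
    a \in Xset S I -> u \in <<I>>%g ->
  (a * u \in Xset S K)%g = (u \in Xset I K).
Proof.
move=> sKI sIS; rewrite (Xset_disjoint cS) // => /andP[Sa aI] Iu.
have cI := cocycle_sub cS sIS; have Su := subsetP (genS sIS) u Iu.
rewrite (mem_Xset cS) ?(subset_trans sKI) // (mem_Xset cI) // Iu groupM //=.
apply: eq_forallb_in => r Kr.
by rewrite invMg (coset_cocycle cS sIS) ?groupV // mem_gen // (subsetP sKI).
Qed.

(** Sort the elements of X_J by the minimal element d of their right coset of
<<I>>. *)
Lemma mackey_xelt I J : I \subset S -> J \subset S ->
  xelt S J = \sum_(d in (Xset S I)^-1%g :&: Xset S J)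
               xelt I (I :&: (J :^ d^-1)%g) * gelt d.
Proof.
move=> sIS sJS; pose min_part w := ((coset_part N I w)^-1 * w)%g.
rewrite /xelt (partition_big min_part (mem ((Xset S I)^-1%g :&: Xset S J))).
  apply: eq_bigr => d /setIP[XId XJd].
  rewrite mulr_suml (reindex_inj (mulIg d)) /=.
  have := XId; rewrite (XsetV_disjoint cS) // => /andP[Sd dI].
  apply: eq_big => [u|u _]; last by rewrite gelt_mul.
  rewrite /min_part mulgA -[X in _ == X]mul1g (inj_eq (mulIg d)) -eq_mulVg1.
  have [Iu | nIu] := boolP (u \in <<I>>%g).
    by rewrite (coset_partE cS) // eqxx andbT (Xset_coset_r sIS) // XJd.
  rewrite [RHS]inE (negPf nIu) andbC;apply: contraNF nIu => /andP[/eqP pE Xud].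
  have Sud : (u * d)%g \in <<S>>%g by move: Xud; rewrite inE => /andP[].
  by have [Ip _] := coset_partP cS sIS Sud; rewrite -pE.
move=> w XJw; have Sw : w \in <<S>>%g by move: XJw; rewrite inE => /andP[].
have [Ip pI] := coset_partP cS sIS Sw.
have Xd : min_part w \in ((Xset S I)^-1)%g.
  by rewrite (XsetV_disjoint cS) // pI groupM // groupV (subsetP (genS sIS)).
apply/setIP; split=> //; move: XJw; rewrite -{1}(mulKVg (coset_part N I w) w).
by rewrite (Xset_coset_r sIS) // => /andP[].
Qed.

(** Minimal representatives modulo <<K>> factor through those modulo <<I>>. *)
Lemma xelt_mul_parabolic I K : K \subset I -> I \subset S ->
  xelt S I * xelt I K = xelt S K.
Proof.
move=> sKI sIS; pose min_part w := (w * coset_part N I w^-1)%g.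
rewrite /xelt [RHS](partition_big min_part (mem (Xset S I))).
  rewrite mulr_suml; apply: eq_bigr => a Xa.
  rewrite mulr_sumr [RHS](reindex_inj (mulgI a)) /=.
  have := Xa; rewrite (Xset_disjoint cS) // => /andP[Sa aI].
  apply: eq_big => [u|u _]; last by rewrite gelt_mul.
  rewrite /min_part -mulgA -[X in _ == X]mulg1 (inj_eq (mulgI a)) invMg.
  have [Iu | nIu] := boolP (u \in <<I>>%g).
    rewrite (coset_partE cS) ?groupV // mulgV eqxx andbT.
    by rewrite (Xset_coset_l _ sIS).
  rewrite [LHS]inE (negPf nIu); symmetry.
  apply: contraNF nIu => /andP[Xau]; rewrite -eq_invg_mul => /eqP uE.
  have Sau : (u^-1 * a^-1)%g \in <<S>>%g.
    by rewrite -invMg groupV; move: Xau; rewrite inE => /andP[].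
  by have [Ip _] := coset_partP cS sIS Sau; rewrite -groupV uE.
move=> w XKw; have Sw : w \in <<S>>%g by move: XKw; rewrite inE => /andP[].
have [Ip pI] := coset_partP cS sIS (groupVr Sw).
rewrite /= (Xset_disjoint cS) // /min_part invMg pI andbT groupM //.
exact: subsetP (genS sIS) _ Ip.
Qed.

(** The descent conditions of w at r and of w d at r ^ d differ by whether r is
an inversion of d, which is excluded. *)
Lemma xelt_mul_gelt K d : K \subset S -> (K :^ d)%g \subset S ->
    d \in ((Xset S K)^-1)%g ->
  xelt S K * gelt d = xelt S (K :^ d)%g.
Proof.
move=> sKS sKdS; rewrite (mem_XsetV cS) // => /andP[Sd /forall_inP Nd].
rewrite {2}/xelt (reindex_inj (mulIg d)) /xelt mulr_suml /=.
apply: eq_big => [w|w _]; last by rewrite gelt_mul.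
rewrite !(mem_Xset cS) // groupMr //; apply: andb_id2l => Sw.
have NE r : r \in K -> (r ^ d \in N (w * d)^-1)%g = (r \in N w^-1)%g.
  move=> Kr; rewrite invMg (cocycleM cS) ?groupV // (cocycleV cS _ Sd) //.
  by rewrite conjgK (negPf (Nd r Kr)).
apply/forall_inP/forall_inP=> NK r Kr; last by rewrite -NE ?NK ?memJ_conjg.
by move: Kr; rewrite mem_conjg => Kr; rewrite -[r](conjgKV d) NE // NK.
Qed.

(** Solomon's theorem.  Multiplying the decomposition of x_J along the cosets
of <<I>> by x_I turns each summand into a basis element. *)
Lemma Sigma_mul x y : x \in Sigma S -> y \in Sigma S -> x * y \in Sigma S.
Proof.
move=> Sx Sy; elim/Sigma_ind: x / Sx => [|x z IHx IHz|a x IHx|I sIS].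
- by rewrite mul0r mem0v.
- by rewrite mulrDl memvD.
- by rewrite -scalerAl memvZ.
elim/Sigma_ind: y / Sy => [|y z IHy IHz|a y IHy|J sJS].
- by rewrite mulr0 mem0v.
- by rewrite mulrDr memvD.
- by rewrite -scalerAr memvZ.
rewrite (mackey_xelt sIS sJS) mulr_sumr memv_suml // => d /setIP[XId _].
rewrite mulrA xelt_mul_parabolic ?subsetIl //.
have sKd : ((I :&: (J :^ d^-1)) :^ d \subset S)%g.
  by rewrite conjIg conjsgKV (subset_trans (subsetIr _ _)).
rewrite xelt_mul_gelt ?xelt_Sigma //; first by rewrite subIset ?sIS.
move: XId; rewrite !(mem_XsetV cS) ?subIset ?sIS // => /andP[-> /forall_inP Nd].
by apply/forall_inP=> r /setIP[/Nd].
Qed.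

Lemma xelt_full : xelt S S = 1.
Proof.
rewrite /xelt (_ : Xset S S = [set 1%g]) ?big_set1 //.
apply/setP=> w; rewrite (Xset_disjoint cS) // inE.
apply/andP/eqP=> [[Sw dW] | ->].
  by apply: invg_inj; rewrite invg1; apply: (cocycle_eq0 cS); rewrite ?groupV.
rewrite group1; split=> //; apply/pred0P=> g /=.
by rewrite invg1 (cocycle1 cS).
Qed.

Lemma Sigma1 : 1 \in Sigma S.
Proof. by rewrite -xelt_full xelt_Sigma. Qed.

Lemma Sigma_supported x : x \in Sigma S -> gsupported <<S>>%g x.
Proof.
move=> Sx g nSg; elim/Sigma_ind: x / Sx => [|x y IHx IHy|a x IHx|I _].
- by rewrite gcoef0.
- by rewrite gcoefD IHx IHy addr0.
- by rewrite gcoefZ IHx mulr0.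
by rewrite gcoef_sum_gelt inE (negPf nSg).
Qed.

(** The formula defining parabolic restriction is the decomposition of x_I
along the cosets of <<K>> with the representatives d erased. *)
Lemma Res_parabolicE K x : K \subset S -> x \in Sigma S ->
  Res_parabolic S K x = glift (coset_part N K) x.
Proof.
move=> sKS Sx; elim/Sigma_ind: x / Sx => [|x y IHx IHy|a x IHx|I sIS].
- by rewrite !linear0.
- by rewrite !linearD /= IHx IHy.
- by rewrite !linearZ /= IHx.
rewrite /Res_parabolic descent_map_xelt // (mackey_xelt sKS sIS) linear_sum.
apply: eq_bigr => d /setIP[]; rewrite (XsetV_disjoint cS) // => /andP[Sd dK] _.
rewrite mulr_suml linear_sum; apply: eq_bigr => u /=.
rewrite inE => /andP[Ku _].
by rewrite gelt_mul glift_gelt (coset_partE cS).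
Qed.

Lemma Res_parabolic_Sigma K x :
  x \in Sigma S -> Res_parabolic S K x \in Sigma K.
Proof.
move=> Sx; elim/Sigma_ind: x / Sx => [|x y IHx IHy|a x IHx|I sIS].
- by rewrite linear0 mem0v.
- by rewrite linearD memvD.
- by rewrite linearZ memvZ.
rewrite /Res_parabolic descent_map_xelt //.
by apply: memv_suml => d _; rewrite xelt_Sigma ?subsetIl.
Qed.

End Cocycle.
End SolomonAlgebra.

(** * The subgroup generated by R and its conjugate by t *)

Section Twist.

Local Open Scope group_scope.

Variables (gT : finGroupType) (t : gT).
Implicit Types (S I J K : {set gT}) (w g u v d r : gT).

(** If I generates a type B group with special generator t, this is the set of
type D generators. *)
Definition twist I : {set gT} := (I :\ t) :|: (I :\ t) :^ t.

Lemma twistS I S : I \subset S -> twist I \subset twist S.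
Proof. by move=> sIS; apply: setUSS; rewrite ?conjSg setSD. Qed.

Lemma sub_twist I S : I \subset S -> t \notin I -> I \subset twist S.
Proof.
move=> sIS It; apply: subset_trans (subsetUl _ _).
by rewrite subsetD1 sIS It.
Qed.

Lemma mem_twist I r : r \in I -> r != t -> r \in twist I.
Proof. by move=> Ir rt; rewrite !inE Ir rt. Qed.

Section Involution.

Hypothesis tt : t * t = 1.

Lemma tV : t^-1 = t. Proof. by apply/eqP; rewrite eq_invg_mul tt. Qed.

Lemma conjtK g : (g ^ t) ^ t = g. Proof. by rewrite -conjgM tt conjg1. Qed.

Lemma mem_conjt A g : (g \in A :^ t) = (g ^ t \in A).
Proof. by rewrite mem_conjg tV. Qed.

Lemma conjst I : (I :^ t) :^ t = I. Proof. by rewrite -conjsgM tt conjsg1. Qed.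

Lemma twistJ I : twist I :^ t = twist I.
Proof. by rewrite conjUg conjst setUC. Qed.

Lemma mem_gen_twistJ I g : (g ^ t \in <<twist I>>) = (g \in <<twist I>>).
Proof. by rewrite -mem_conjt -genJ twistJ. Qed.

Variables (I : {set gT}) (It : t \in I).

Lemma gen_twist_sub : <<twist I>> \subset <<I>>.
Proof.
rewrite gen_subG subUset (subset_trans (subsetDl _ _)) ?subset_gen //=.
apply/subsetP=> g; rewrite mem_conjt inE => /andP[_ Ig].
by rewrite -[g]conjtK groupJ // mem_gen.
Qed.

(** The generated subgroup is stable under conjugation by t, so together with
its translate by t it is closed under right multiplication by I. *)
Lemma gen_twist_index w : w \in <<I>> ->
  (w \in <<twist I>>) || (w * t \in <<twist I>>).
Proof.
elim/gen_ind_r=> [|u r Iu Ir]; first by rewrite group1.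
have [-> | rt] := eqVneq r t; first by rewrite orbC -mulgA tt mulg1.
have Tr : r \in <<twist I>> by rewrite mem_gen ?mem_twist.
have Tr' : r ^ t \in <<twist I>> by rewrite mem_gen_twistJ.
case/orP=> Tu; first by rewrite groupM.
apply/orP; right; rewrite -(groupMr _ Tr') in Tu.
by move: Tu; rewrite conjgE tV !mulgA -(mulgA u) tt mulg1.
Qed.

End Involution.

Section Cocycle.

Variables (N : gT -> {set gT}) (S : {set gT}).
Hypotheses (cS : reflection_cocycle N S) (St : t \in S).
Hypothesis nTt : t \notin <<twist S>>.

Let tt : t * t = 1. Proof. by case: cS => /(_ t St). Qed.
Let sTS : <<twist S>> \subset <<S>> := gen_twist_sub tt St.
Let Wt : t \in <<S>> := mem_gen St.

Lemma gen_twist_mult w : w \in <<S>> ->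
  (w * t \in <<twist S>>) = (w \notin <<twist S>>).
Proof.
move=> /(gen_twist_index tt).
have [Tw _ | _ /= ->] //= := boolP (w \in <<twist S>>).
by apply: contraNF nTt => Twt; rewrite -(groupMl _ Tw).
Qed.

Lemma gen_twist_norm w g : w \in <<S>> ->
  (g ^ w \in <<twist S>>) = (g \in <<twist S>>).
Proof.
have normT u : u \in <<twist S>> ->
    (g ^ u \in <<twist S>>) = (g \in <<twist S>>).
  exact: groupJr.
case/(gen_twist_index tt)/orP=> Tw; first exact: normT.
by rewrite -(mulgK t w) (tV tt) conjgM mem_gen_twistJ // normT.
Qed.

Lemma gen_cap_twist I : I \subset S -> t \in I ->
  <<I>> :&: <<twist S>> = <<twist I>>.
Proof.
move=> sIS It; apply/setP=> w; apply/setIP/idP=> [[Iw Tw] | Tw].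
  case/(gen_twist_index tt)/orP: Iw => // TIwt.
  have /(subsetP (genS (twistS sIS))) := TIwt.
  by rewrite (groupMl _ Tw) (negPf nTt).
by rewrite (subsetP (gen_twist_sub tt It)) // (subsetP (genS (twistS sIS))).
Qed.

Lemma gen_cap_twist_gens I : I \subset S -> t \in I ->
  <<I>> :&: twist S = twist I.
Proof.
move=> sIS It; have gI r : r \in S -> r \in <<I>> -> r \in I.
  by move=> Sr; rewrite (gen_parabolic cS sIS).
apply/setP=> w; apply/setIP/idP=> [[Iw] | Tw].
  rewrite !inE => /orP[/andP[wt Sw] | ]; first by rewrite wt gI.
  rewrite (mem_conjt tt) inE => /andP[wt Sw]; rewrite (mem_conjt tt) inE wt.
  by rewrite (gI _ Sw) ?orbT // groupJ // mem_gen.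
rewrite (subsetP (twistS sIS)) //; split=> //.
by apply: (subsetP (gen_twist_sub tt It)); rewrite mem_gen.
Qed.

(** The conjugates of t are the reflections that get discarded. *)
Definition even_cocycle w := N w :&: <<twist S>>.

Lemma even_cocycleM u v g : u \in <<S>> -> v \in <<S>> ->
  (g \in even_cocycle (u * v))
    = (g \in even_cocycle u) (+) (g ^ u \in even_cocycle v).
Proof.
move=> Su Sv; rewrite !inE (cocycleM cS) // gen_twist_norm //.
by case: (g \in <<_>>); rewrite ?andbT ?andbF.
Qed.

Lemma even_cocycle_t g : (g \in even_cocycle t) = false.
Proof.
rewrite inE; case: cS => _ /(_ t St)-> _; rewrite inE.
by case: eqP => // ->; apply: negPf.
Qed.

Lemma even_cocycle_mult w :
  w \in <<S>> -> even_cocycle (w * t) = even_cocycle w.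
Proof.
by move=> Sw; apply/setP=> g; rewrite even_cocycleM // even_cocycle_t addbF.
Qed.

Lemma even_cocycle_tmul w g : w \in <<S>> ->
  (g \in even_cocycle (t * w)) = (g ^ t \in even_cocycle w).
Proof. by move=> Sw; rewrite even_cocycleM // even_cocycle_t. Qed.

(** The inversions of t s t are t, t s t and t s t s t; the first and the last
are conjugates of t, so only t s t remains. *)
Lemma twist_cocycle : reflection_cocycle even_cocycle (twist S).
Proof.
have [invS NS _] := cS.
have even_gen r : r \in S -> r != t -> even_cocycle r = [set r].
  move=> Sr rt; apply/setP=> g; rewrite in_setI (NS _ Sr) !in_set1.
  by case: eqP => //= ->; rewrite mem_gen ?mem_twist.
split=> [r|r|u v Tu Tv g]; last by rewrite even_cocycleM // (subsetP sTS).
  rewrite !inE => /orP[/andP[_ /invS] // | ].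
  rewrite (mem_conjt tt) !inE => /andP[_ /invS rr].
  by apply: (conjg_inj t); rewrite conjMg rr conj1g.
rewrite !inE => /orP[/andP[rt Sr] | ]; first exact: even_gen.
rewrite (mem_conjt tt) !inE => /andP[rt Sr]; apply/setP=> g.
have Wr : r ^ t \in <<S>> by rewrite mem_gen.
have {1}-> : r = t * (r ^ t * t).
  by rewrite conjgE (tV tt) -!mulgA tt mulg1 mulgA tt mul1g.
rewrite (even_cocycle_tmul _ (groupM Wr Wt)) even_cocycle_mult //.
by rewrite even_gen // !inE (inj_eq (conjg_inj t)).
Qed.

End Cocycle.
End Twist.

(** * The restriction map between descent algebras *)

Section Projection.

Variables (gT : finGroupType) (t : gT).
Implicit Types (S I J K : {set gT}) (w g u v d r : gT) (x y : group_algebra gT).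

(** For w in the group generated by S, the element of w<t> lying in the
subgroup of index 2. *)
Definition twist_proj S w : gT :=
  if w \in <<twist t S>>%g then w else (w * t)%g.

(** The map Res_n, for any S and t. *)
Definition Res_twist S : 'End(group_algebra gT) :=
  descent_map S (fun I =>
    if t \in I then xelt (twist t S) (<<I>>%g :&: twist t S)
    else xelt (twist t S) I + xelt (twist t S) (I :^ t^-1)%g).

Lemma sigma_tE x : sigma_t t x = gelt t * x * gelt t^-1%g.
Proof.
pose f y := gelt t * y * gelt t^-1%g.
have lin_f : linear f.
  by move=> a y z; rewrite /f mulrDr mulrDl -scalerAr -scalerAl.
pose flM := GRing.isLinear.Build _ _ _ _ f lin_f.
pose fL : {linear group_algebra gT -> group_algebra gT} := HB.pack f flM.
exact: (lfunE fL x).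
Qed.

Lemma glift_mul_eq (A : {set gT}) (f h : gT -> gT) x z : gsupported A x ->
    {in A, forall w, gelt (f w) * z = gelt (h w) * z} ->
  glift f x * z = glift h x * z.
Proof.
move=> sx eq_fh; rewrite !mulr_suml; apply: eq_bigr => g _.
have [Ag | /sx->] := boolP (g \in A); last by rewrite !scale0r.
by rewrite -!scalerAl eq_fh.
Qed.

Lemma glift_comp (f h : gT -> gT) x :
  glift f (glift h x) = glift (f \o h) x.
Proof.
rewrite {2}/glift linear_sum; apply: eq_bigr => g _.
by rewrite linearZ /= glift_gelt.
Qed.

Lemma glift_id x : glift id x = x.
Proof. by rewrite [RHS]geltE. Qed.

Section Cocycle.

Variables (N : gT -> {set gT}) (S : {set gT}).
Hypotheses (cS : reflection_cocycle N S) (St : t \in S).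
Hypothesis nTt : t \notin <<twist t S>>%g.

Let tt : (t * t = 1)%g. Proof. by case: cS => /(_ t St). Qed.
Let sTS : <<twist t S>>%g \subset <<S>>%g := gen_twist_sub tt St.
Let Wt : t \in <<S>>%g := mem_gen St.
Let cT : reflection_cocycle (even_cocycle t N S) (twist t S) :=
  twist_cocycle cS St nTt.

Lemma big_gen_twist (V : nmodType) (P : pred gT) (F : gT -> V) :
  \sum_(w in <<S>>%g | P w) F w
    = \sum_(w in <<twist t S>>%g | P w) F w
      + \sum_(w in <<twist t S>>%g | P (w * t)%g) F (w * t)%g.
Proof.
rewrite (bigID (mem <<twist t S>>%g)) /=; congr (_ + _).
  apply: eq_bigl => w; rewrite andbC andbA; congr (_ && _).
  by apply: andb_idr; apply: subsetP.
rewrite (reindex_inj (mulIg t)); apply: eq_bigl => w /=.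
rewrite groupMr // andbAC; congr (_ && _).
have [Sw | nSw] := boolP (w \in <<S>>%g).
  by rewrite (gen_twist_mult cS) // negbK.
by symmetry; apply: contraNF nSw; apply: subsetP.
Qed.

Lemma sum_gen_twist (V : nmodType) (F : gT -> V) :
  \sum_(w in <<S>>%g) F w
    = \sum_(w in <<twist t S>>%g) F w + \sum_(w in <<twist t S>>%g) F (w * t)%g.
Proof.
by have := big_gen_twist xpredT F; rewrite !(eq_bigl _ _ (fun w => andbT _)).
Qed.

Lemma mem_twist_proj w : w \in <<S>>%g -> twist_proj S w \in <<twist t S>>%g.
Proof.
move=> Sw; rewrite /twist_proj; case: ifPn => // nTw.
by rewrite (gen_twist_mult cS).
Qed.

Lemma twist_proj_gelt w :
  gelt (twist_proj S w) * (1 + gelt t) = gelt w * (1 + gelt t).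
Proof.
rewrite /twist_proj; case: ifP => // _.
by rewrite !mulrDr !mulr1 !gelt_mul -mulgA tt mulg1 addrC.
Qed.

Lemma glift_twist_proj x :
  glift (twist_proj S) x * (1 + gelt t) = x * (1 + gelt t).
Proof.
rewrite -{2}(glift_id x); apply: (@glift_mul_eq setT) => [g|w _].
  by rewrite inE.
exact: twist_proj_gelt.
Qed.

Lemma mem_Xset_twist J v : J \subset twist t S -> v \in <<twist t S>>%g ->
  (v \in Xset (twist t S) J) = [forall r in J, r \notin N v^-1%g].
Proof.
move=> sJT Tv; rewrite (mem_Xset cT) // Tv /=; apply: eq_forallb_in => r Jr.
by rewrite inE mem_gen ?andbT // (subsetP sJT).
Qed.

Lemma cocycle_invMt v g : v \in <<S>>%g ->
  (g \in N (v * t)^-1)%g = (g == t) (+) (g ^ t \in N v^-1)%g.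
Proof.
move=> Sv; rewrite invMg (tV tt) (cocycleM cS) ?groupV //.
by case: cS => _ /(_ t St)-> _; rewrite inE.
Qed.

(** For v in the subgroup, its coefficient on the left counts which of v, vt lie
in X_I.  If t is not in I the two memberships are the descent conditions of v
for I and for t I t.  If t is in I, then t is a descent of exactly one of v and
vt; the other one lies in X_I as soon as v has no descent in twist t I, and
conversely a minimal coset representative modulo <<I>> has no inversion in
<<I>>, in particular none in twist t I. *)
Lemma glift_proj_xelt I : I \subset S ->
  glift (twist_proj S) (xelt S I)
    = if t \in I then xelt (twist t S) (<<I>>%g :&: twist t S)
      else xelt (twist t S) I + xelt (twist t S) (I :^ t^-1)%g.
Proof.
move=> sIS; have sXS (J : {set gT}) K w : w \in Xset J K -> w \in <<J>>%g.
  by rewrite inE => /andP[].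
have ->: glift (twist_proj S) (xelt S I)
    = \sum_(v in <<twist t S>>%g | v \in Xset S I) gelt v
      + \sum_(v in <<twist t S>>%g | (v * t)%g \in Xset S I) gelt v.
  transitivity (\sum_(w in <<S>>%g | w \in Xset S I) gelt (twist_proj S w)).
    rewrite linear_sum; apply: eq_big => [w | w _]; last exact: glift_gelt.
    by apply/idP/andP=> [Xw | []//]; rewrite (sXS S I).
  rewrite big_gen_twist; congr (_ + _); apply: eq_bigr => w /andP[Tw _].
    by rewrite /twist_proj Tw.
  rewrite /twist_proj (gen_twist_mult cS) ?(subsetP sTS) // Tw /=.
  by rewrite -mulgA tt mulg1.
have XE v : v \in <<twist t S>>%g ->
    (v \in Xset S I) = [forall r in I, r \notin N v^-1%g].
  by move=> Tv; rewrite (mem_Xset cS) // (subsetP sTS).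
have XtE v : v \in <<twist t S>>%g ->
    (v * t \in Xset S I)%g = [forall r in I, (r == t) == (r ^ t \in N v^-1)%g].
  move=> Tv; have Sv := subsetP sTS v Tv.
  rewrite (mem_Xset cS) // groupM //; apply: eq_forallb_in => r _.
  by rewrite cocycle_invMt //; case: (_ == _); case: (_ \in _).
case: ifPn => It.
  have sJT := twistS t sIS; rewrite (gen_cap_twist_gens cS) //.
  have Itw : twist t I \subset <<I>>%g.
    by rewrite (subset_trans (subset_gen _)) // gen_twist_sub.
  have It' := mem_gen It; have nt r : r \in twist t I -> r != t.
    move=> /(subsetP sJT) Tr; apply: contraNneq nTt => def_r.
    by apply: mem_gen; rewrite def_r in Tr.
  (* Of v and vt, the one that can lie in X_I is that without descent t. *)
  rewrite [RHS](bigID (fun v => t \notin N v^-1%g)); congr (_ + _).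
    apply: eq_bigl => v; apply/andP/andP=> [[Tv Xv] | [Xv Nt]].
      have := Xv; rewrite (Xset_disjoint cS) // => /andP[_ vI].
      rewrite mem_Xset_twist // (disjointFl vI It'); split=> //.
      by apply/forall_inP=> r /(subsetP Itw) Ir; rewrite (disjointFl vI Ir).
    have Tv := sXS _ _ _ Xv; split=> //; rewrite XE //.
    move: Xv; rewrite mem_Xset_twist // => /forall_inP NI.
    apply/forall_inP=> r Ir; have [-> // | rt] := eqVneq r t.
    by apply: NI; apply: mem_twist.
  apply: eq_bigl => v; rewrite negbK; apply/andP/andP=> [[Tv Xv] | [Xv Nt]].
    have Sv := subsetP sTS v Tv.
    have := Xv; rewrite (Xset_disjoint cS) // => /andP[_ vI].
    have NE g : g \in <<I>>%g -> (g ^ t \in N v^-1)%g = (g == t).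
      move=> /(disjointFl vI); rewrite cocycle_invMt //.
      by case: (_ == _); case: (_ \in _).
    rewrite mem_Xset_twist //; split; last first.
      by have := NE t It'; rewrite conjgE mulKg eqxx.
    apply/forall_inP=> r Tr; have Ir := subsetP Itw r Tr.
    have := NE (r ^ t)%g (groupJ Ir It'); rewrite (conjtK tt) => ->.
    by apply: nt; rewrite -(mem_conjt tt) (twistJ tt).
  have Tv := sXS _ _ _ Xv; split=> //; rewrite XtE //.
  move: Xv; rewrite mem_Xset_twist // => /forall_inP NI.
  apply/forall_inP=> r Ir; have [-> | rt] := eqVneq r t.
    by rewrite conjgE mulKg Nt.
  rewrite eq_sym eqbF_neg; apply: NI.
  by rewrite -(mem_conjt tt) (twistJ tt) mem_twist.
have sIR : I \subset twist t S := sub_twist sIS It.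
rewrite (tV tt); congr (_ + _).
  apply: eq_bigl => v; apply/andP/idP=> [[Tv Xv] | Xv].
    by rewrite mem_Xset_twist // -XE.
  by have Tv := sXS _ _ _ Xv; rewrite Tv XE // -mem_Xset_twist.
have sItT : (I :^ t)%g \subset twist t S by rewrite -(twistJ tt) conjSg.
have XtIE v : v \in <<twist t S>>%g ->
    (v * t \in Xset S I)%g = (v \in Xset (twist t S) (I :^ t)%g).
  move=> Tv; rewrite mem_Xset_twist // XtE //.
  apply/forall_inP/forall_inP=> NI r.
    rewrite (mem_conjt tt) => Ir; have /eqP := NI _ Ir.
    by rewrite (conjtK tt) => <-; apply: contraNneq It => <-.
  move=> Ir; have := NI (r ^ t)%g; rewrite (mem_conjt tt) (conjtK tt) Ir.
  move/(_ isT)/negPf->; rewrite eqbF_neg.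
  by apply: contraNneq It => <-.
apply: eq_bigl => v; apply/andP/idP=> [[Tv] | Xv]; first by rewrite XtIE.
by have Tv := sXS _ _ _ Xv; rewrite Tv XtIE.
Qed.

Lemma Res_twist_xelt I : I \subset S ->
  Res_twist S (xelt S I)
    = if t \in I then xelt (twist t S) (<<I>>%g :&: twist t S)
      else xelt (twist t S) I + xelt (twist t S) (I :^ t)%g.
Proof. by move=> sIS; rewrite /Res_twist (descent_map_xelt cS) // (tV tt). Qed.

Lemma Res_twistE x : x \in Sigma S -> Res_twist S x = glift (twist_proj S) x.
Proof.
move=> Sx; elim/Sigma_ind: x / Sx => [|x y IHx IHy|a x IHx|I sIS].
- by rewrite !linear0.
- by rewrite !linearD /= IHx IHy.
- by rewrite !linearZ /= IHx.
by rewrite Res_twist_xelt // glift_proj_xelt // (tV tt).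
Qed.

Lemma Res_twist_Sigma x : x \in Sigma S -> Res_twist S x \in Sigma (twist t S).
Proof.
move=> Sx; elim/Sigma_ind: x / Sx => [|x y IHx IHy|a x IHx|I sIS].
- by rewrite linear0 mem0v.
- by rewrite linearD memvD.
- by rewrite linearZ memvZ.
rewrite Res_twist_xelt //; case: ifPn => [_ | It].
  by rewrite xelt_Sigma ?subsetIr.
have sIR := sub_twist sIS It.
by rewrite memvD ?xelt_Sigma // -(twistJ tt) conjSg.
Qed.

Lemma xelt_twistJ J : J \subset twist t S ->
  gelt t * xelt (twist t S) J * gelt t = xelt (twist t S) (J :^ t)%g.
Proof.
move=> sJT.
have sJtT : (J :^ t)%g \subset twist t S by rewrite -(twistJ tt) conjSg.
rewrite /xelt mulr_sumr mulr_suml [RHS](reindex_inj (conjg_inj t)) /=.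
apply: eq_big => [w | w _]; last by rewrite !gelt_mul conjgE (tV tt) mulgA.
rewrite !(mem_Xset cT) // mem_gen_twistJ //; apply: andb_id2l => Tw.
have Sw := subsetP sTS w Tw.
have NE r : (r \in even_cocycle t N S (w ^ t)^-1)%g
    = (r ^ t \in even_cocycle t N S w^-1)%g.
  rewrite -conjVg conjgE (tV tt) (even_cocycle_tmul cS) ?groupM ?groupV //.
  by rewrite (even_cocycle_mult cS) // groupV.
apply/forall_inP/forall_inP=> NJ r Jr; last first.
  by rewrite -[r](conjtK tt) -NE NJ // (mem_conjt tt) conjtK.
by rewrite NE NJ // -(mem_conjt tt).
Qed.

Lemma Res_twist_fixed x : x \in Sigma S ->
  gelt t * Res_twist S x * gelt t = Res_twist S x.
Proof.
move=> Sx; elim/Sigma_ind: x / Sx => [|x y IHx IHy|a x IHx|I sIS].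
- by rewrite linear0 mulr0 mul0r.
- by rewrite linearD mulrDr mulrDl /= IHx IHy.
- by rewrite linearZ -scalerAr -scalerAl /= IHx.
rewrite Res_twist_xelt //; case: ifPn => It.
  rewrite xelt_twistJ ?subsetIr // (gen_cap_twist_gens cS) //.
  by rewrite (twistJ tt).
have sIR := sub_twist sIS It.
rewrite mulrDr mulrDl !xelt_twistJ // ?(conjst tt) 1?addrC //.
by rewrite -(twistJ tt) conjSg.
Qed.

Lemma Res_twist_mul x : x \in Sigma S ->
  Res_twist S x * (1 + gelt t) = x * (1 + gelt t).
Proof. by move=> Sx; rewrite Res_twistE // glift_twist_proj. Qed.

(** Res_n(x) commutes with t, so 1 + t may be moved to its other side. *)
Theorem Res_twist_intertwines x : x \in Sigma S ->
  (1 + gelt t) * Res_twist S x = x * (1 + gelt t).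
Proof.
move=> Sx; rewrite -Res_twist_mul // mulrDl mulrDr mul1r mulr1.
have gtt : gelt t * gelt t = 1 by rewrite gelt_mul tt.
by congr (_ + _); rewrite -[in RHS](Res_twist_fixed Sx) -!mulrA gtt mulr1.
Qed.

(** Both sides are supported on the subgroup and agree after multiplication by
1 + t, which is moved from right to left past Res_n(y). *)
Theorem Res_twistM x y : x \in Sigma S -> y \in Sigma S ->
  Res_twist S (x * y) = Res_twist S x * Res_twist S y.
Proof.
move=> Sx Sy; have Sxy := Sigma_mul cS Sx Sy.
have supp z : z \in Sigma (twist t S) -> gsupported <<twist t S>>%g z.
  exact: Sigma_supported.
apply: (gmul_1gelt_inj nTt); first exact/supp/Res_twist_Sigma.
  by apply: gsupportedM; apply/supp/Res_twist_Sigma.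
rewrite Res_twist_mul // -[in RHS]mulrA (Res_twist_mul Sy).
rewrite -[x * y * _]mulrA -(Res_twist_intertwines Sy) !mulrA.
by rewrite Res_twist_mul.
Qed.

Theorem Res_twist1 : Res_twist S 1 = 1.
Proof.
rewrite Res_twistE ?(Sigma1 cS) // glift_gelt /twist_proj.
by rewrite group1.
Qed.

(** The formula for the induced character of 1 counts the w in <<S>> with g ^ w
in <<I>>; splitting the count over the two cosets gives either twice the count
for <<twist t I>>, of index 2 in <<I>>, or the counts for <<I>> and its
conjugate. *)
Theorem theta_Res_twist x : x \in Sigma S ->
  theta (twist t S) (Res_twist S x) = 'Res[<<twist t S>>%g] (theta S x).
Proof.
have thetaD (A : {set gT}) y z : theta A (y + z) = theta A y + theta A z.
  rewrite /theta -big_split; apply: eq_bigr => i _ /=.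
  by rewrite linearD rmorphD scalerDl.
have thetaZ (A : {set gT}) a y : theta A (a *: y) = ratr a *: theta A y.
  rewrite /theta scaler_sumr; apply: eq_bigr => i _ /=.
  by rewrite linearZ rmorphM scalerA.
move=> Sx; elim/Sigma_ind: x / Sx => [|x y IHx IHy|a x IHx|I sIS].
- have theta0 (A : {set gT}) : theta A 0 = 0.
    by rewrite -[0 in LHS](scale0r 0) thetaZ rmorph0 scale0r.
  by rewrite linear0 !theta0 linear0.
- by rewrite linearD !thetaD IHx IHy linearD.
- by rewrite linearZ !thetaZ IHx linearZ.
rewrite Res_twist_xelt // (theta_xelt cS) //.
have sWI := genS sIS.
apply/cfun_inP=> g Tg; have Sg := subsetP sTS g Tg.
rewrite cfResE // cfIndE //.
have -> : \sum_(w in <<S>>%g) (1 : 'CF(<<I>>%g)) (g ^ w)%g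
   = \sum_(w in <<twist t S>>%g) ((g ^ w)%g \in <<I>>%g)%:R
     + \sum_(w in <<twist t S>>%g) ((g ^ w) ^ t \in <<I>>)%g%:R.
  under eq_bigr do rewrite cfun1E.
  rewrite sum_gen_twist; congr (_ + _).
  by apply: eq_bigr => w _; rewrite conjgM.
have IndT (J : {set gT}) : J \subset twist t S ->
    'Ind[<<twist t S>>%g, <<J>>%g] 1 g
      = #|<<J>>%g|%:R^-1
        * \sum_(w in <<twist t S>>%g) ((g ^ w)%g \in <<J>>%g)%:R.
  move=> sJT; rewrite cfIndE ?genS //; congr (_ * _).
  by apply: eq_bigr => w _; rewrite cfun1E.
case: ifPn => It.
  have capI w : (w \in <<twist t I>>%g)
      = (w \in <<twist t S>>%g) && (w \in <<I>>%g).
    by rewrite -(gen_cap_twist cS) // inE andbC.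
  have cardI : (#|<<I>>%g|%:R : algC) = 2 * #|<<twist t I>>%g|%:R.
    have := big_gen_twist (mem <<I>>%g) (fun=> 1 : algC).
    under [X in _ = _ + X]eq_bigl do rewrite /= groupMr ?(mem_gen It) // -capI.
    under [X in _ = X + _]eq_bigl do rewrite /= -capI.
    rewrite !sumr_const -mulr2n mulr_natl => <-.
    congr (_%:R); apply: eq_card => w.
    rewrite -[RHS]/((w \in <<S>>%g) && (w \in <<I>>%g)).
    by symmetry; apply: andb_idl; apply: subsetP.
  rewrite (gen_cap_twist_gens cS) // (theta_xelt cT) ?twistS //.
  rewrite IndT ?twistS // cardI invfM -mulrA.
  have -> : \sum_(w in <<twist t S>>%g) ((g ^ w) ^ t \in <<I>>)%g%:R
      = \sum_(w in <<twist t S>>%g) (g ^ w \in <<I>>)%g%:R :> algC.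
    by apply: eq_bigr => w _; rewrite groupJr // mem_gen.
  set m := \sum_(w in _) (g ^ w \in <<I>>)%g%:R.
  have -> : m + m = 2 * m by rewrite mulr_natl mulr2n.
  rewrite mulrCA mulKf ?pnatr_eq0 //.
  by congr (_ * _); apply: eq_bigr => w Tw; rewrite capI groupJ.
have sIR := sub_twist sIS It.
have sItR : (I :^ t)%g \subset twist t S by rewrite -(twistJ tt) conjSg.
rewrite thetaD !(theta_xelt cT) // cfunE !IndT //.
rewrite genJ cardJg mulrDr; congr (_ + _ * _); apply: eq_bigr => w _.
by rewrite (mem_conjt tt).
Qed.

(** An element fixed by t is the mean of its conjugates, hence a combination of
the sums x_J + x_{tJt}. *)
Theorem Res_twist_image :
    (forall J, J \subset twist t S ->
       [\/ J \subset S :\ t, (J :^ t)%g \subset S :\ t | (J :^ t)%g = J]) ->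
  (Res_twist S @: Sigma S)%VS
    = (Sigma (twist t S) :&: fixedSpace (sigma_t t))%VS.
Proof.
move=> J_cases; apply/eqP; rewrite eqEsubv; apply/andP; split.
  apply/subvP=> _ /memv_imgP[x Sx ->]; rewrite memv_cap Res_twist_Sigma //.
  by apply/fixedSpaceP; rewrite sigma_tE (tV tt) Res_twist_fixed.
have sym_image J : J \subset twist t S ->
    xelt (twist t S) J + xelt (twist t S) (J :^ t)%g
      \in (Res_twist S @: Sigma S)%VS.
  have low I : I \subset S :\ t ->
      xelt (twist t S) I + xelt (twist t S) (I :^ t)%g
        \in (Res_twist S @: Sigma S)%VS.
    rewrite subsetD1 => /andP[sIS It].
    apply/memv_imgP; exists (xelt S I); first exact: xelt_Sigma.
    by rewrite Res_twist_xelt // (negPf It).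
  move=> sJT; case: (J_cases J sJT) => [/low // | /low | JtJ].
    by rewrite (conjst tt) addrC.
  (* When J is t-stable, J is the twist of {t} + (J /\ S), and x_J + x_{tJt}
     is twice x_J. *)
  pose I := t |: (J :&: S); have It : t \in I by rewrite setU11.
  have sIS : I \subset S by rewrite subUset sub1set St subsetIr.
  have nJt r : r \in J -> r != t.
    move=> Jr; apply: contraNneq nTt => def_r.
    by apply: mem_gen; apply: (subsetP sJT); rewrite -def_r.
  have TI : twist t I = J.
    have mJ r : (r ^ t \in J)%g = (r \in J) by rewrite -(mem_conjt tt) JtJ.
    have mI r : (r \in I :\ t) = (r \in J) && (r \in S).
      rewrite in_setD1 in_setU1 in_setI; have [-> | //] := eqVneq r t.
      by apply/esym/negbTE; apply/negP=> /andP[/nJt/eqP].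
    apply/setP=> r; rewrite in_setU (mem_conjt tt) !mI mJ -andb_orr.
    apply: andb_idr => Jr; move: (subsetP sJT r Jr).
    rewrite in_setU (mem_conjt tt) !in_setD1.
    by case/orP=> /andP[_ ->]; rewrite ?orbT.
  rewrite JtJ; apply/memv_imgP; exists (2 *: xelt S I).
    by rewrite memvZ ?xelt_Sigma.
  rewrite linearZ /= Res_twist_xelt // It (gen_cap_twist_gens cS) // TI.
  by rewrite scaler_nat mulr2n.
apply/subvP=> x; rewrite memv_cap => /andP[Tx /fixedSpaceP].
rewrite sigma_tE (tV tt) => fix_x.
have -> : x = 2^-1 *: (x + gelt t * x * gelt t).
  by rewrite fix_x -mulr2n -scaler_nat scalerA mulVf ?scale1r.
apply: memvZ; elim/Sigma_ind: x / Tx {fix_x} => [|x y IHx IHy|a x IHx|J sJT].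
- by rewrite mulr0 mul0r addr0 mem0v.
- by rewrite mulrDr mulrDl addrACA memvD.
- by rewrite -scalerAr -scalerAl -scalerDr memvZ.
by rewrite xelt_twistJ // sym_image.
Qed.

End Cocycle.

(** Let w = u d with u in <<K>> and d minimal, and let q and v be the elements
of u<t> and w<t> in the subgroup of index 2.  Then q^-1 v is obtained from d by
multiplications by t, which do not create even inversions in <<K>>, so q is the
component of v; and 1 + t does not distinguish q from u. *)
Theorem Res_twist_parabolic N S K x : reflection_cocycle N S ->
    t \in K -> K \subset S -> t \notin <<twist t S>>%g -> x \in Sigma S ->
  Res_parabolic (twist t S) (twist t K) (Res_twist S x)
    = Res_twist K (Res_parabolic S K x).
Proof.
move=> cS Kt sKS nTt Sx; have cK := cocycle_sub cS sKS.
have St := subsetP sKS t Kt; have tt : (t * t = 1)%g by case: cS => /(_ t St).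
have sTK := twistS t sKS.
have nKt : t \notin <<twist t K>>%g := contra (subsetP (genS sTK) t) nTt.
have cT := twist_cocycle cS St nTt; have sTS := gen_twist_sub tt St.
have RSx := Res_twist_Sigma cS St Sx.
have RKx := Res_parabolic_Sigma cS K Sx.
apply: (gmul_1gelt_inj nKt).
- by apply: Sigma_supported; apply: (Res_parabolic_Sigma cT).
- by apply: Sigma_supported; apply: (Res_twist_Sigma cK).
rewrite (Res_twist_mul cK) // (Res_parabolicE cT) // (Res_parabolicE cS) //.
rewrite (Res_twistE cS) // glift_comp.
apply: (glift_mul_eq (Sigma_supported Sx)) => w Sw /=.
have [Ku dK] := coset_partP cS sKS Sw; set u := coset_part N K w in Ku dK *.
rewrite -(twist_proj_gelt cK Kt u); congr (gelt _ * _).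
have Kq := mem_twist_proj cK Kt nKt Ku.
rewrite -(mulKVg (twist_proj K u) (twist_proj S w)).
apply: (coset_partE cT) => //.
  by rewrite groupM ?(mem_twist_proj cS) // groupV (subsetP (genS sTK)).
rewrite -setI_eq0; apply/eqP/setP=> g; rewrite in_setI in_set0; apply/negP.
set d := (u^-1 * w)%g in dK *.
have Sd : d \in <<S>>%g by rewrite groupM // groupV (subsetP (genS sKS)).
have Nd h : h \in <<K>>%g -> h \notin even_cocycle t N S d.
  by move=> Kh; rewrite inE (disjointFl dK).
case/andP=> + Tg; have Kg := subsetP (gen_twist_sub tt Kt) g Tg.
have -> : even_cocycle t N S ((twist_proj K u)^-1 * twist_proj S w)
    = even_cocycle t N S ((twist_proj K u)^-1 * w)%g.
  rewrite {2}/twist_proj; case: ifP => // _.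
  rewrite mulgA (even_cocycle_mult cS) //.
  by rewrite groupM // groupV (subsetP sTS) // (subsetP (genS sTK)).
rewrite /twist_proj; case: ifP => _; first exact/negP/Nd.
rewrite invMg (tV tt) -mulgA (even_cocycle_tmul cS) //.
by apply/negP/Nd; rewrite groupJ // mem_gen.
Qed.

End Projection.

(** * Type B and type D *)

Section TypeB.

Local Open Scope group_scope.

Variables (gT : finGroupType) (t : gT).
Implicit Types (S J : {set gT}) (r w : gT).

(** The assignment t |-> -1, r |-> 1 respects the Coxeter relations when all
t r have even order; it extends to a character trivial on twist t S. *)
Lemma gen_twist_even S : coxeter_system S -> t \in S ->
    {in S, forall r, r != t -> ~~ odd #[t * r]} ->
  t \notin <<twist t S>>.
Proof.
case=> ordS univ St even_t.
pose sgn r : {perm bool} := if r == t then tperm false true else 1.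
have [r r' Sr Sr'|F FM FS] := univ _ sgn.
  rewrite /sgn; case: eqP => [->|/eqP rt]; case: eqP => [->|/eqP rt'].
  - by rewrite tperm2 expg1n.
  - rewrite mulg1 -(odd_double_half #[_]) (negPf (even_t _ Sr' rt')) add0n.
    by rewrite -muln2 mulnC expgM expgS expg1 tperm2 expg1n.
  - have ->: #[r * t] = #[t * r].
      by rewrite -(orderJ (t * r) t) conjgE -mulgA mulKg.
    rewrite mul1g -(odd_double_half #[_]) (negPf (even_t _ Sr rt)) add0n.
    by rewrite -muln2 mulnC expgM expgS expg1 tperm2 expg1n.
  by rewrite mulg1 expg1n.
have tt : t * t = 1 by have := expg_order t; rewrite ordS // expgS expg1.
have F1 : F 1 = 1.
  by apply: (mulgI (F 1)); rewrite -FM ?group1 // !mulg1.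
have Ft : F t = tperm false true by rewrite FS // /sgn eqxx.
have FR r : r \in S -> r != t -> F r = 1.
  by move=> Sr /negPf rt; rewrite FS // /sgn rt.
have Wt := mem_gen St; have sTS := subsetP (gen_twist_sub tt St).
have FT w : w \in <<twist t S>> -> F w = 1.
  move=> Tw; elim/gen_ind_r: w / Tw => [//|u r Tu Tr Fu].
  rewrite FM ?sTS ?(mem_gen Tr) // Fu mul1g.
  case/setUP: Tr => [/setD1P[rt Sr] | ]; first exact: FR.
  rewrite (mem_conjt tt) => /setD1P[rt Sr].
  have Wr := mem_gen Sr.
  rewrite -(conjtK tt r) [_ ^ t]conjgE (tV tt) (FM _ _ Wt (groupM Wr Wt)).
  by rewrite (FM _ _ Wr Wt) Ft FR // mul1g; apply: tperm2.
apply/negP=> /FT; rewrite Ft => /permP/(_ false).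
by rewrite tpermL perm1.
Qed.

(** Conjugation by t moves at most s1 among the elements of S - {t}, so what
matters is which of s1 and t s1 t belong to J. *)
Lemma twist_subset_cases S s1 J : t * t = 1 ->
    {in S :\ t, forall r, r != s1 -> r ^ t = r} -> J \subset twist t S ->
  [\/ J \subset S :\ t, J :^ t \subset S :\ t | J :^ t = J].
Proof.
move=> tt fix_t sJT.
have low (A : {set gT}) :
  A \subset twist t S -> s1 ^ t \notin A -> A \subset S :\ t.
  move=> sAT As; apply/subsetP=> r Ar.
  have := subsetP sAT r Ar; rewrite in_setU (mem_conjt tt) => /orP[//|Rr].
  have [rs1 | rs1] := eqVneq (r ^ t) s1.
    by rewrite -rs1 (conjtK tt) Ar in As.
  by have := fix_t _ Rr rs1; rewrite (conjtK tt) => ->.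
have [Js' | ] := boolP (s1 ^ t \in J); last by move/(low _ sJT); constructor 1.
have [Js | nJs] := boolP (s1 \in J); last first.
  constructor 2; apply: low; first by rewrite -(twistJ tt) conjSg.
  by rewrite memJ_conjg.
have fixJ r : r \in J -> r ^ t \in J.
  move=> Jr; have [-> // | rs1] := eqVneq r s1.
  have [-> | rs1'] := eqVneq r (s1 ^ t); first by rewrite (conjtK tt).
  have := subsetP sJT r Jr; rewrite in_setU (mem_conjt tt) => /orP[Rr|Rr].
    by rewrite (fix_t _ Rr rs1).
  have rts1 : r ^ t != s1.
    by apply: contraNneq rs1' => <-; rewrite (conjtK tt).
  by have := fix_t _ Rr rts1; rewrite (conjtK tt) => <-.
constructor 3; apply/setP=> r; rewrite (mem_conjt tt).
by apply/idP/idP=> /fixJ; rewrite ?(conjtK tt).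
Qed.

Variable s : nat -> gT.

Lemma mem_gensA m r :
  reflect (exists2 i, (0 < i < m)%N & r = s i)
          (r \in [set s i | i : 'I_m & (0 < i)%N]).
Proof.
apply: (iffP imsetP) => [[i] | [i /andP[i0 im] ->]].
  by rewrite inE => i0 ->; exists i; rewrite ?i0 /=.
by exists (Ordinal im); rewrite ?inE.
Qed.

Section Generators.

Variable m : nat.
Hypotheses (tt : t * t = 1) (neq_t : forall i, (0 < i < m)%N -> s i != t).

Lemma gensB_D1 : gensB m t s :\ t = [set s i | i : 'I_m & (0 < i)%N].
Proof.
apply/setP=> r; rewrite in_setD1 in_setU1; have [-> | //] := eqVneq r t.
apply/esym/negbTE/negP=> /mem_gensA[i im /esym/eqP].
by rewrite (negPf (neq_t _)).
Qed.

Lemma gensDE : (forall i, (1 < i < m)%N -> commute t (s i)) ->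
  gensD m t s = twist t (gensB m t s).
Proof.
move=> comm_t; rewrite /twist gensB_D1 /gensD; apply/setP=> r.
rewrite in_setU (mem_conjt tt); case: leqP => m1.
  rewrite inE; apply/esym/negbTE; rewrite negb_or.
  by apply/andP; split; apply/mem_gensA=> -[i]; lia.
rewrite in_setU1 orbC.
have [//= | nR] := boolP (r \in _).
apply/eqP/mem_gensA=> [-> | [i im rti]].
  by exists 1%N => //; rewrite conjgE (tV tt) !mulgA tt mul1g -mulgA tt mulg1.
have def_r : r = s i ^ t by rewrite -rti (conjtK tt).
have [i1 | i1] := eqVneq i 1%N; first by rewrite def_r i1 conjgE (tV tt) mulgA.
have i_gt1 : (1 < i < m)%N by lia.
case/mem_gensA: nR; exists i => //; rewrite def_r.
by apply/conjg_fixP/commgP/commute_sym/comm_t.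
Qed.

End Generators.

End TypeB.

Theorem proposition4p14 (gT : finGroupType) (n : nat) (t : gT) (s : nat -> gT) :
  (0 < n)%N -> coxeter_type_B n t s ->
  let S := gensB n t s in
  let S' := gensD n t s in
  let Res := Res_BD n t s in
  [/\ (* (a) *)
      forall x, x \in Sigma S -> (1 + gelt t) * Res x = x * (1 + gelt t),
      (* (b) *)
      (forall x, x \in Sigma S -> Res x \in Sigma S') /\ ahom_in (Sigma S) Res,
      (* (c) *)
      (1 < n)%N -> forall x, x \in Sigma S ->
        Res_parabolic S' (gensD n.-1 t s) (Res x)
        = Res_BD n.-1 t s (Res_parabolic S (gensB n.-1 t s) x),
      (* (d) *)
      forall x, x \in Sigma S ->
        theta S' (Res x) = 'Res[<<S'>>%g] (theta S x)
    & (* (e) *)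
      (Res @: Sigma S)%VS = (Sigma S' :&: fixedSpace (sigma_t t))%VS].
Proof.
move=> n_gt0 [coxS cardS ord4 _ [comm_t _]] S S' Res.
have St : t \in S by rewrite setU11.
have tt : (t * t = 1)%g.
  by case: coxS => /(_ t St) o2 _; have := expg_order t; rewrite o2 expgS expg1.
(* The set of the s i has at most n - 1 elements, so t has to be a further one
   for the generators to number n. *)
have neq_t i : (0 < i < n)%N -> s i != t.
  move=> in_i; have ltR : (#|[set s i | i : 'I_n & (0 < i)%N]| < n)%N.
    apply: leq_ltn_trans (leq_imset_card _ _) _.
    rewrite -[X in (_ < X)%N]card_ord; apply: proper_card; apply/properP.
    by split; [apply/subsetP | exists (Ordinal n_gt0); rewrite ?inE].
  apply: contraTneq ltR => si_t; rewrite -leqNgt -{1}cardS.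
  rewrite /S /gensB cardsU1 (_ : t \in _) //.
  by apply/mem_gensA; exists i.
have [N cS] := coxeter_cocycle coxS.
have S'E : S' = twist t S.
  by apply: gensDE => // i /andP[]; apply: comm_t.
have ResE : Res = Res_twist t S by rewrite /Res /Res_BD -/S' S'E.
have nTt : t \notin <<twist t S>>%g.
  apply: gen_twist_even => // r Sr rt.
  have : r \in S :\ t by rewrite in_setD1 rt.
  rewrite gensB_D1 // => /mem_gensA[i /andP[i0 lt_in] def_r].
  have [i1 | i1] := eqVneq i 1%N; first by rewrite def_r i1 ord4 //; lia.
  (* The commuting involutions t and r differ, so t r has order 2. *)
  have ct : commute t r by rewrite def_r; apply: comm_t => //; lia.
  have rr : (r * r = 1)%g by case: cS => /(_ r Sr).
  have tr1 : (t * r != 1)%g.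
    by apply: contraNneq rt => tr; rewrite -(mulKg t r) tr mulg1 (tV tt).
  have : (#[t * r]%g %| 2)%N.
    by rewrite order_dvdn expgMn // !expgS !expg0 !mulg1 tt rr mulg1.
  rewrite -order_eq1 in tr1; move/(dvdn_leq (ltn0Sn 1)); move: tr1.
  by have := order_gt0 (t * r)%g; case: #[_]%g => [|[|[|k]]].
rewrite ResE S'E; split.
- by move=> x Sx; apply: (Res_twist_intertwines cS).
- split=> [x Sx|]; first exact: (Res_twist_Sigma cS St).
  apply/ahom_inP; split; last exact: (Res_twist1 cS).
  by move=> x y Sx Sy; apply: (Res_twistM cS).
- move=> n_gt1 x Sx.
  rewrite /Res_BD; have -> : gensD n.-1 t s = twist t (gensB n.-1 t s).
    by apply: gensDE => // i im; [apply: neq_t | apply: comm_t]; lia.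
  have sKS : gensB n.-1 t s \subset S.
    apply/subsetP=> r; rewrite !in_setU1 => /orP[-> // | /mem_gensA[i im ->]].
    by apply/orP; right; apply/mem_gensA; exists i => //; lia.
  by apply: (Res_twist_parabolic cS) => //; rewrite setU11.
- by move=> x Sx; apply: (theta_Res_twist cS).
apply: (Res_twist_image cS) => // J.
apply: (twist_subset_cases (s1 := s 1%N)) => // r.
rewrite gensB_D1 // => /mem_gensA[i im ->] si1.
apply/conjg_fixP/commgP/commute_sym/comm_t; last by case/andP: im.
by case: i im si1 => [|[|i]] //; rewrite eqxx.
Qed.
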